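(* The polynomials $P_{\alpha,\beta,\gamma,\delta}$ with $(\alpha,\beta,\gamma,\delta)\in\binom{[c]}{4}$, $Q_{\alpha,\beta,\gamma,\delta}$ with $(\alpha,\beta,\gamma,\delta)\in\binom{[c-d]}{4}$, and $L_{\alpha,\beta,\gamma},M_{\alpha,\beta,\gamma}$ with $(\alpha,\beta,\gamma)\in\binom{[c]}{3}$, which are the minimal generators of the defining ideal $\mathcal{J}=\ker\Pi_{\mathcal R}$ of the Rees ring of a rational normal scroll, form a squarefree quadratic Gröbner basis of $\mathcal{J}$ (i.e. a Gröbner basis of quadrics with squarefree leading monomials) with respect to the term order $\prec$.
   Context: Let $\mathbb{K}$ be an arbitrary field, $d\ge1$, $1\le n_1\le\cdots\le n_d$ integers, $c=\sum_i n_i$. Write $[n]=\{1,\ldots,n\}$ and $\binom{\Gamma}{k}$ for the set of strictly increasing $k$-tuples of elements of $\Gamma$. Let $R=\mathbb{K}[x_{i,j}\mid 1\le i\le d,\ 0\le j\le n_i]$. Matrix $\mathbf{M}$: the $2\times c$ matrix whose columns are $\binom{x_{i,j}}{x_{i,j+1}}$ for $1\le i\le d$, $0\le j\le n_i-1$, in the following order. The first $c-d$ columns are those with $j\le n_i-2$, ordered by increasing $j$ and, for equal $j$, by increasing $i$. The last $d$ columns are those with $j=n_i-1$, ordered by decreasing $i$. Its entries are $\mu_{i,j}$, and $g_{\alpha,\beta}=\mu_{1,\alpha}\mu_{2,\beta}-\mu_{1,\beta}\mu_{2,\alpha}$. The ideal $I=(g_{\alpha,\beta}\mid(\alpha,\beta)\in\binom{[c]}{2})$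 is the ideal of the rational normal scroll $\mathcal{S}_{n_1,\ldots,n_d}\subseteq\mathbb{P}^{c+d-1}$; its Rees ring is $\mathcal{R}(I)=R[It]\subseteq R[t]$. For $\alpha\in[c-d]$, if the $\alpha$-th column of $\mathbf{M}$ is $\binom{x_{i,j}}{x_{i,j+1}}$, then $\overline{\alpha}\in[c]$ is the index of the column $\binom{x_{i,j+1}}{x_{i,j+2}}$. Presentation: $S_{\mathcal R}=R[T_{\alpha,\beta}\mid(\alpha,\beta)\in\binom{[c]}{2}]$ and $\Pi_{\mathcal R}:S_{\mathcal R}\to\mathcal{R}(I)$, $T_{\alpha,\beta}\mapsto t g_{\alpha,\beta}$, $x_{i,j}\mapsto x_{i,j}$. Conventions: $T_{\alpha,\beta}=-T_{\beta,\alpha}$ if $\alpha>\beta$, and $T_{\alpha,\alpha}=0$. Define $$L_{\alpha,\beta,\gamma}=\mu_{1,\alpha}T_{\beta,\gamma}-\mu_{1,\beta}T_{\alpha,\gamma}+\mu_{1,\gamma}T_{\alpha,\beta},\qquad M_{\alpha,\beta,\gamma}=\mu_{2,\alpha}T_{\beta,\gamma}-\mu_{2,\beta}T_{\alpha,\gamma}+\mu_{2,\gamma}T_{\alpha,\beta},$$ $$P_{\alpha,\beta,\gamma,\delta}=T_{\alpha,\beta}T_{\gamma,\delta}-T_{\alpha,\gamma}T_{\beta,\delta}+T_{\alpha,\delta}T_{\beta,\gamma},$$ $$Q_{\alpha,\beta,\gamma,\delta}=T_{\alpha,\beta}T_{\overline{\gamma},\overline{\delta}}-T_{\alpha,\gamma}T_{\overline{\beta},\overline{\delta}}+T_{\alpha,\delta}T_{\overline{\beta},\overline{\gamma}}+T_{\beta,\gamma}T_{\overline{\alpha},\overline{\delta}}-T_{\beta,\delta}T_{\overline{\alpha},\overline{\gamma}}+T_{\gamma,\delta}T_{\overline{\alpha},\overline{\beta}}.$$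 Term order $\prec$ on $S_{\mathcal R}$: set $\mathrm{mdeg}(T_{\alpha,\beta})=\mathbf{e}_{\alpha+d}+\mathbf{e}_{\beta+d}$, $\mathrm{mdeg}(\mu_{2,\gamma})=\mathbf{e}_{\gamma+d}$, $\mathrm{mdeg}(x_{i,0})=\mathbf{e}_i$ in $\mathbb{N}^{c+d}$, and $\mathrm{sdeg}(T_{\alpha,\beta})=c-\alpha$ (for $\alpha<\beta$), $\mathrm{sdeg}(x_{i,j})=0$, all extended additively to monomials; $\mathbb{N}^{c+d}$ is ordered lexicographically with $\mathbf{e}_1>\cdots>\mathbf{e}_{c+d}$. Two monomials are compared first by $\mathrm{mdeg}$ (larger is larger), then by $\mathrm{sdeg}$ (larger is larger), then by the lexicographic order induced by the following total order on the variables: $T_{\alpha,\beta}\succ T_{\gamma,\delta}$ if $\alpha<\gamma$, or $\alpha=\gamma$ and $\beta<\delta$; $x_{i,j}\succ x_{k,\ell}$ if $j<n_i$, $\ell<n_k$ and either $j<\ell$, or $j=\ell$ and $i<k$; $x_{i,j}\succ x_{k,n_k}$ if $j<n_i$, or $j=n_i$ and $i>k$; $x_{i,j}\succ T_{\alpha,\beta}$ always. *)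

(* Defs.v *)
From HB Require Import structures.
From mathcomp Require Import all_boot all_order all_algebra.
From mathcomp Require Import mpoly.

Set Implicit Arguments.
Unset Strict Implicit.
Unset Printing Implicit Defensive.

Import GRing.Theory.

Local Open Scope ring_scope.

(** * Generated ideals and Rees rings *)

Section Ideals.
Context (A : comNzRingType).
Implicit Types (G H J : A -> Prop).

Definition ideal_gen G (f : A) : Prop :=
  exists2 s : seq (A * A),
    (forall p, p \in s -> G p.2) & f = \sum_(p <- s) p.1 * p.2.

Definition generates G J : Prop := forall f, J f <-> ideal_gen G f.

Definition minimal_generators G J : Prop :=
  generates G J /\
  (forall H, (forall g, H g -> G g) -> generates H J -> forall g, G g -> H g).

(* The subring A[It] of A[t] generated by A and the a t with a in I. *)
Inductive rees_ring (I : A -> Prop) : {poly A} -> Prop :=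
| ReesConst a : rees_ring I a%:P
| ReesGen a : I a -> rees_ring I (a *: 'X)
| ReesAdd p q : rees_ring I p -> rees_ring I q -> rees_ring I (p + q)
| ReesMul p q : rees_ring I p -> rees_ring I q -> rees_ring I (p * q).

End Ideals.

(** * Groebner bases for an arbitrary strict order on monomials *)

Section Groebner.
Context (K : fieldType) (N : nat) (lt : rel 'X_{1..N}).
Implicit Types (f : {mpoly K[N]}) (G J : {mpoly K[N]} -> Prop).

Definition is_lead f (m : 'X_{1..N}) : Prop :=
  m \in msupp f /\ (forall m', m' \in msupp f -> m' != m -> lt m' m).

Definition initial_ideal J : {mpoly K[N]} -> Prop :=
  ideal_gen (fun u => exists f m, [/\ J f, is_lead f m & u = 'X_[m]]).

(* [initial_ideal G] is the ideal spanned by the leading monomials of the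
   elements of [G], also when [G] is not an ideal. *)
Definition groebner_basis G J : Prop :=
  (forall g, G g -> J g) /\ (forall f, initial_ideal J f <-> initial_ideal G f).

Definition squarefree (m : 'X_{1..N}) : Prop := forall i, (m i <= 1)%N.

End Groebner.

(* [gt i j] means that the index [i] is larger than the index [j]. *)
Definition lexlt (I : finType) (gt : rel I) (u w : I -> nat) : bool :=
  [exists i, (u i < w i)%N && [forall j, gt j i ==> (u j == w j)]].

(** * Rational normal scrolls

   Indices start from 0: the paper's i in {1..d} and alpha in [c] are [i.-1] in
   ['I_d] and [alpha.-1] in ['I_c]; the second index j of x_{i,j} is unshifted. *)

Section Scroll.
Context (K : fieldType) (d : nat) (n : 'I_d -> nat).

Definition ncols : nat := \sum_(i < d) n i.
Local Notation c := ncols.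

(* [existT _ i j] stands for the column (x_{i,j}, x_{i,j+1}). *)
Definition column : finType := {i : 'I_d & 'I_(n i)}.

Definition inner_col (p : column) : bool := ((tagged p).+1 < n (tag p))%N.

Definition column_le (p q : column) : bool :=
  if inner_col p then
    if inner_col q then
      (tagged p < tagged q)%N ||
      ((tagged p == tagged q :> nat) && (tag p <= tag q)%N)
    else true
  else if inner_col q then false else (tag q <= tag p)%N.

Definition columns : seq column := sort column_le (enum {: column}).

Lemma size_columns : size columns == c.
Proof.
rewrite size_sort -cardE card_tagged sumnE big_map big_enum /=.
by apply/eqP/eq_bigr => i _; rewrite card_ord.
Qed.

Definition col (a : 'I_c) : column := tnth (Tuple size_columns) a.

(* Meaningful only if [a] is among the first c - d columns. *)
Definition bar (a : 'I_c) : 'I_c :=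
  odflt a [pick b | (tag (col b) == tag (col a)) &&
                    (tagged (col b) == (tagged (col a)).+1 :> nat)].

Definition xvar : finType := {i : 'I_d & 'I_(n i).+1}.

(* Only used with j <= n i. *)
Definition mk_x (i : 'I_d) (j : nat) : xvar :=
  Tagged (fun i => 'I_(n i).+1) (inord j : 'I_(n i).+1).

Definition mu1 (a : 'I_c) : xvar := mk_x (tag (col a)) (tagged (col a)).
Definition mu2 (a : 'I_c) : xvar := mk_x (tag (col a)) (tagged (col a)).+1.

Definition tvar : finType := {p : 'I_c * 'I_c | (p.1 < p.2)%N}.

Definition var : finType := (xvar + tvar)%type.

Definition Rring : comNzRingType := {mpoly K[#|xvar|]}.

Definition XR (x : xvar) : Rring := 'X_(enum_rank x).

Definition minor (a b : 'I_c) : Rring :=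
  XR (mu1 a) * XR (mu2 b) - XR (mu1 b) * XR (mu2 a).

Definition scroll_ideal : Rring -> Prop :=
  ideal_gen (fun f => exists a b : 'I_c, (a < b)%N /\ f = minor a b).

(* S_R = R[T] is taken to be the polynomial ring over K in all the x and T. *)
Definition Sring : comNzRingType := {mpoly K[#|var|]}.

Definition XS (x : xvar) : Sring := 'X_(enum_rank (inl x : var)).

Definition T (a b : 'I_c) : Sring :=
  if insub (a, b) is Some u then 'X_(enum_rank (inr u : var))
  else if insub (b, a) is Some u then - 'X_(enum_rank (inr u : var))
  else 0.

Definition Pi_var (v : var) : {poly Rring} :=
  match v with
  | inl x => (XR x)%:P
  | inr u => minor (val u).1 (val u).2 *: 'X
  end.

(* Pi_R followed by the inclusion of the Rees ring into R[t]; see [Pi_image]. *)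
Definition Pi (f : Sring) : {poly Rring} :=
  mmap (polyC \o @mpolyC #|xvar| K) (fun i => Pi_var (enum_val i)) f.

Lemma PiX (v : var) : Pi 'X_(enum_rank v) = Pi_var v.
Proof. by rewrite /Pi mmapX mmap1U enum_rankK. Qed.

Lemma Pi_const (a : Rring) : exists f, Pi f = a%:P.
Proof.
pose lft := mmap (@mpolyC #|var| K) (fun i => XS (enum_val i)) : Rring -> Sring.
exists (lft a); move: a; apply: mpolyind => [|k m p _ _ IH].
  by rewrite /lft mmap0 /Pi mmap0 polyC0.
rewrite /lft mmapD [Pi _]mmapD polyCD -/(Pi (mmap _ _ p)) IH; congr (_ + _).
rewrite mmapZ rmorphM /= mmapC -mul_mpolyC polyCM; congr (_ * _).
rewrite mmapX /mmap1 rmorph_prod /= mpolyXE_id rmorph_prod /=.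
apply: eq_bigr => i _; rewrite !rmorphXn /= [mmap _ _ _]PiX /=.
by rewrite /XR enum_valK.
Qed.

Lemma Pi_image (p : {poly Rring}) :
  (exists f, Pi f = p) <-> rees_ring scroll_ideal p.
Proof.
split=> [[f <-]|].
  rewrite /Pi /mmap; elim/big_ind: _ => [|? ?|m _]; last 1 first.
  - apply: ReesMul; first exact: ReesConst.
    rewrite /mmap1; elim/big_ind: _ => [|? ?|i _]; last 1 first.
    + elim: (m i) => [|k IH]; first by rewrite expr0 -polyC1; apply: ReesConst.
      rewrite exprS; apply: ReesMul => {IH} //.
      case: (enum_val i) => [x|[[a b] /= ab]]; first exact: ReesConst.
      apply: ReesGen; exists [:: (1, minor a b)]; last first.
        by rewrite big_seq1 mul1r.
      by move=> q; rewrite inE => /eqP -> /=; exists a, b; split.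
    + by rewrite -polyC1; apply: ReesConst.
    + exact: ReesMul.
  - by rewrite -polyC0; apply: ReesConst.
  - exact: ReesAdd.
elim=> {p} [a|a [s Hs ->]|p q _ [f <-] _ [g <-]|p q _ [f <-] _ [g <-]].
- exact: Pi_const.
- elim: s Hs => {a} [|[u w] s IH] Hs.
    by exists 0; rewrite big_nil scale0r /Pi mmap0.
  have [|f Hf] := IH; first by move=> q qs; apply: Hs; rewrite inE qs orbT.
  have [/= a [b [ab ->]]] := Hs _ (mem_head _ _).
  have [g Hg] := Pi_const u.
  exists (g * 'X_(enum_rank (inr (exist _ (a, b) ab) : var)) + f).
  rewrite big_cons scalerDl -Hf [LHS]mmapD; congr (_ + _).
  by rewrite rmorphM /= [X in X * _]Hg [X in _ * X]PiX mul_polyC scalerA.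
- by exists (f + g); rewrite [LHS]mmapD.
- by exists (f * g); rewrite [LHS]rmorphM.
Qed.

Definition rees_ideal (f : Sring) : Prop := Pi f = 0.

Definition L (a b g : 'I_c) : Sring :=
  XS (mu1 a) * T b g - XS (mu1 b) * T a g + XS (mu1 g) * T a b.

Definition M (a b g : 'I_c) : Sring :=
  XS (mu2 a) * T b g - XS (mu2 b) * T a g + XS (mu2 g) * T a b.

Definition P (a b g e : 'I_c) : Sring :=
  T a b * T g e - T a g * T b e + T a e * T b g.

Definition Q (a b g e : 'I_c) : Sring :=
  T a b * T (bar g) (bar e) - T a g * T (bar b) (bar e)
  + T a e * T (bar b) (bar g) + T b g * T (bar a) (bar e)
  - T b e * T (bar a) (bar g) + T g e * T (bar a) (bar b).

Inductive rees_gens : Sring -> Prop :=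
| GenP (a b g e : 'I_c) : (a < b < g)%N -> (g < e)%N -> rees_gens (P a b g e)
| GenQ (a b g e : 'I_c) : (a < b < g)%N -> (g < e)%N -> (e < c - d)%N ->
    rees_gens (Q a b g e)
| GenL (a b g : 'I_c) : (a < b < g)%N -> rees_gens (L a b g)
| GenM (a b g : 'I_c) : (a < b < g)%N -> rees_gens (M a b g).

(** ** The term order *)

(* e_1, ..., e_d are the [lshift]s and e_{d+1}, ..., e_{d+c} the [rshift]s. The
   variables x_{i,j} with j > 0 are exactly the entries of the second row. *)
Definition var_mdeg (v : var) : 'X_{1..d + c} :=
  match v with
  | inl x => if [pick a | mu2 a == x] is Some a
             then U_(rshift d a)%MM else U_(lshift c (tag x))%MM
  | inr u => (U_(rshift d (val u).1) + U_(rshift d (val u).2))%MM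
  end.

(* The successor accounts for indices starting from 0. *)
Definition var_sdeg (v : var) : nat :=
  if v is inr u then (c - (val u).1.+1)%N else 0%N.

Definition mon_mdeg (m : 'X_{1..#|var|}) (k : 'I_(d + c)) : nat :=
  (\sum_(i < #|var|) m i * var_mdeg (enum_val i) k)%N.

Definition mon_sdeg (m : 'X_{1..#|var|}) : nat :=
  (\sum_(i < #|var|) m i * var_sdeg (enum_val i))%N.

Definition xvar_gt (x y : xvar) : bool :=
  let: (i, j) := (tag x, tagged x : nat) in
  let: (k, l) := (tag y, tagged y : nat) in
  if (l < n k)%N then (j < n i)%N && ((j < l)%N || ((j == l) && (i < k)%N))
  else (j < n i)%N || (k < i)%N.

Definition tvar_gt (u w : tvar) : bool :=
  ((val u).1 < (val w).1)%N ||
  (((val u).1 == (val w).1) && ((val u).2 < (val w).2)%N).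

Definition var_gt (v w : var) : bool :=
  match v, w with
  | inl x, inl y => xvar_gt x y
  | inl _, inr _ => true
  | inr _, inl _ => false
  | inr u, inr w => tvar_gt u w
  end.

Definition mon_lt (m m' : 'X_{1..#|var|}) : bool :=
  let mdeg_gt (k l : 'I_(d + c)) := (k < l)%N in
  let lex_gt (i j : 'I_#|var|) := var_gt (enum_val i) (enum_val j) in
  lexlt mdeg_gt (mon_mdeg m) (mon_mdeg m') ||
  [forall k, mon_mdeg m k == mon_mdeg m' k] &&
  ((mon_sdeg m < mon_sdeg m')%N ||
   (mon_sdeg m == mon_sdeg m') && lexlt lex_gt m m').

End Scroll.

(* Main.v *)
From Stdlib Require Import Classical_Prop.
From mathcomp Require Import all_boot all_order all_algebra.
From mathcomp Require Import mpoly.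
From mathcomp Require Import zify ring.
Require Import Defs.

(** Order the variables of R as z_0, ..., z_{c+d-1}: first the x_{i,0}, then the
    second row of the matrix ([pos]). Column a becomes (z_{w(a)}, z_{d+a}) with
    w(a) < d + a, where w is increasing on the first c - d columns and decreasing
    on the last d. The leading monomials ([gen_lead]) are then
    - T_{a,g} T_{b,e} for P_{a,b,g,e}, two crossing pairs of columns;
    - z_{d+b} T_{a,g} for M_{a,b,g};
    - z_p T_{s,t}, with p smaller than w(s) and w(t), for the L's;
    - T_{a,b} T_{s,t}, with a < b and d + b smaller than w(s) and w(t), for the
      Q's; here s and t are the bars of the last two indices of Q.

    By [criterion_generates], [criterion_groebner] and [criterion_minimal],
    everything follows once the images in R[t] of the standard monomials, those
    divisible by none of the above, are known to be linearly independent
    ([standard_indep]); no S-pair has to be reduced.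

    Linear independence is read off leading terms in R, but if the n_i are
    unbalanced the lexicographic order on R can give two standard monomials the
    same leading term. Instead there is one order for each B < c. Let lam be a
    function on the variables that drops by c - w(a) from the top to the bottom
    of column a, and give z_p the weight lam(z_p) - max(0, B - p) ([nu]). By [nu_diag] the two terms of the minor of
    columns a, b have weights
      lam(z_{d+a}) + lam(z_{d+b}) + c - B - max(0, w(a) - B) - max(0, B - d - b)
    and the same with a and b exchanged. So the image of a monomial has weight
    at most a bound that depends on the monomial only through lam, and the bound
    is attained only if all its variables z_p have p >= B, all its T_{a,b} with
    a < b have d + b >= B, and each of these has w(a) <= B or w(b) <= B
    ([good_mon]). Given a standard monomial of maximal lam in a linear relation,
    the conditions coming from the L's and Q's make it good for some B
    ([standard_good]); for this B the top weight of the relation involves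
    good monomials only.

    Ties between the two terms of a minor are broken by a second weight [rho].
    The leading term of a good monomial is a product of first-row entries of
    position at most B, one for each T, and of second-row entries and x's of
    position at least B. The conditions coming from the P's and M's say that the
    T's are noncrossing arcs with no x under them, and such a configuration is
    determined by these end points by matching parentheses ([lead_mon_inj]). So
    distinct good monomials have distinct leading terms, and no relation is
    possible. *)

Set Implicit Arguments.
Unset Strict Implicit.
Unset Printing Implicit Defensive.

Import GRing.Theory.

Local Open Scope ring_scope.

(** * Positions of the variables of R *)

Section Positions.
Context (d : nat) (n : 'I_d -> nat).
Local Notation c := (ncols n).
Implicit Types (a b e : 'I_c) (x y : xvar n) (p q : column n).

Lemma column_le_total : total (@column_le d n).
Proof.
by move=> [i j] [k l]; rewrite /column_le /inner_col /=; do 2?case: ifP; lia.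
Qed.

Lemma column_le_trans : transitive (@column_le d n).
Proof.
move=> [i j] [k l] [i' j']; rewrite /column_le /inner_col /=.
by do 3?case: ifP; lia.
Qed.

Lemma col_inj : injective (@col d n).
Proof.
move=> a b /eqP; rewrite /col !(tnth_nth (col a)) nth_uniq.
- by move/eqP/val_inj.
- by rewrite (eqP (size_columns n)) ltn_ord.
- by rewrite (eqP (size_columns n)) ltn_ord.
- by rewrite sort_uniq enum_uniq.
Qed.

Lemma col_surj p : exists a, col a = p.
Proof.
have : p \in columns n by rewrite mem_sort mem_enum.
move=> /(nthP p)[k klt <-]; rewrite (eqP (size_columns n)) in klt.
by exists (Ordinal klt); rewrite /col (tnth_nth p).
Qed.

Lemma col_le a b : (a <= b)%N -> column_le (col a) (col b).
Proof.
rewrite leq_eqVlt => /orP[/eqP/val_inj->|ab].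
  by have := column_le_total (col b) (col b); rewrite orbb.
rewrite /col !(tnth_nth (col a)); have p := col a.
apply: (sorted_ltn_nth column_le_trans) => //.
- exact/sort_sorted/column_le_total.
- by rewrite inE (eqP (size_columns n)).
- by rewrite inE (eqP (size_columns n)).
Qed.

Lemma tag_mu1 a : tag (mu1 a) = tag (col a). Proof. by []. Qed.

Lemma tag_mu2 a : tag (mu2 a) = tag (col a). Proof. by []. Qed.

Lemma tagged_mk_x i j : (j <= n i)%N -> tagged (mk_x n i j) = j :> nat.
Proof. by move=> ji; rewrite /= inordK. Qed.

Lemma xvar_eq x y : tag x = tag y -> tagged x = tagged y :> nat -> x = y.
Proof. by case: x y => [i j] [k l] /= E; subst k => /val_inj ->. Qed.

Lemma col_eq p q : tag p = tag q -> tagged p = tagged q :> nat -> p = q.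
Proof. by case: p q => [i j] [k l] /= E; subst k => /val_inj ->. Qed.

Lemma tagged_mu1 a : tagged (mu1 a) = tagged (col a) :> nat.
Proof. by rewrite tagged_mk_x // ltnW. Qed.

Lemma tagged_mu2 a : tagged (mu2 a) = (tagged (col a)).+1 :> nat.
Proof. by rewrite tagged_mk_x. Qed.

Lemma mu1_inj : injective (@mu1 d n).
Proof.
move=> a b E; apply: col_inj; apply: col_eq; first exact: (congr1 tag E).
by rewrite -!tagged_mu1 E.
Qed.

Lemma mu2_inj : injective (@mu2 d n).
Proof.
move=> a b E; apply: col_inj; apply: col_eq; first exact: (congr1 tag E).
by apply: succn_inj; rewrite -!tagged_mu2 E.
Qed.

(** The multidegree of [x] is the unit vector of this index, by [mdeg_xE]. *)
Definition pos x : nat :=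
  if [pick a | mu2 a == x] is Some a then d + a else tag x.

Lemma pos_mu2 a : pos (mu2 a) = (d + a)%N.
Proof.
rewrite /pos; case: pickP => [b /eqP /mu2_inj -> //|/(_ a)].
by rewrite eqxx.
Qed.

Lemma mu2_surj x : (0 < tagged x)%N -> exists a, x = mu2 a.
Proof.
case: x => i [[|j] jn] //= _; have jn' : (j < n i)%N by [].
have [a Ea] := col_surj (Tagged (fun i => 'I_(n i)) (Ordinal jn')).
by exists a; apply: xvar_eq; rewrite ?tagged_mu2 ?tag_mu2 Ea.
Qed.

Lemma mu1_surj x : (tagged x < n (tag x))%N -> exists a, x = mu1 a.
Proof.
move=> jn; have [a Ea] := col_surj (Tagged (fun i => 'I_(n i)) (Ordinal jn)).
by exists a; apply: xvar_eq; rewrite ?tagged_mu1 ?tag_mu1 Ea.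
Qed.

Lemma pos0 x : tagged x = 0%N :> nat -> pos x = tag x.
Proof.
move=> x0; rewrite /pos; case: pickP => // a /eqP Ex.
by move: x0; rewrite -Ex tagged_mu2.
Qed.

Lemma pos_lt_dc x : (pos x < d + c)%N.
Proof.
case: (posnP (tagged x)) => [/pos0->|/mu2_surj[a ->]].
  by rewrite ltn_addr.
by rewrite pos_mu2 ltn_add2l.
Qed.

Lemma mdeg_xE x k : (var_mdeg (inl x : var n) k = (pos x == k))%N.
Proof.
rewrite /var_mdeg /pos; case: pickP => [a _|_]; rewrite mnm1E -val_eqE //=.
Qed.

Context (n_gt0 : forall i : 'I_d, (1 <= n i)%N).

(** On the second row both sides compare columns the way [column_le] does. *)
Lemma xvar_gt_pos x y : xvar_gt x y -> (pos x < pos y)%N.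
Proof.
case: (posnP (tagged y)) => [y0|].
  move: (n_gt0 (tag y)); rewrite (pos0 y0) /xvar_gt y0 => -> /andP[_] /=.
  by case/andP=> /eqP/pos0 ->.
move=> /mu2_surj[b ->]; rewrite pos_mu2.
case: (posnP (tagged x)) => [/pos0->|]; first by rewrite ltn_addr.
move=> /mu2_surj[a ->]; rewrite pos_mu2 ltn_add2l.
case: ltnP => // /col_le; rewrite /xvar_gt !tagged_mu2 /column_le /inner_col.
rewrite !tag_mu2.
case: (col a) (col b) => [i [j ji]] [k [l lk]] /=; do 3?case: ifP; lia.
Qed.

Lemma xvar_gt_total x y : x != y -> xvar_gt x y || xvar_gt y x.
Proof.
case: x y => [i [j ji]] [k [l lk]]; rewrite /xvar_gt /= => ne.
case: (eqVneq i k) => [ik|]; last first.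
  by rewrite -val_eqE /=; do 2?case: ifP; lia.
subst k; have : j != l.
  by apply: contra ne => /eqP jl; apply/eqP/xvar_eq.
by do 2?case: ifP; lia.
Qed.

Lemma pos_inj : injective pos.
Proof.
move=> x y E; apply/eqP; case: eqVneq => // /xvar_gt_total.
by case/orP => /xvar_gt_pos; rewrite E ltnn.
Qed.

Lemma xvar_gtE x y : xvar_gt x y = (pos x < pos y)%N.
Proof.
apply/idP/idP=> [/xvar_gt_pos //|lt].
have : x != y by apply: contraTneq lt => ->; rewrite ltnn.
by move/xvar_gt_total; case/orP=> // /xvar_gt_pos; case: ltngtP lt.
Qed.

Lemma pos_mu1_mu2 a : (pos (mu1 a) < d + a)%N.
Proof.
rewrite -pos_mu2 -xvar_gtE /xvar_gt tagged_mu1 tagged_mu2 ?tag_mu1 ?tag_mu2.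
by case: (col a) => i [j ji] /=; case: ifP; lia.
Qed.

Lemma d_le_c : (d <= c)%N.
Proof.
rewrite /ncols -[X in (X <= _)%N]card_ord -sum1_card.
by apply: leq_sum => i _.
Qed.

Lemma card_outer : #|[pred a : 'I_c | ~~ inner_col (col a)]| = d.
Proof.
have last_lt i : ((n i).-1 < n i)%N by rewrite prednK.
pose lastc (i : 'I_d) : column n := Tagged (fun i => 'I_(n i)) (Ordinal (last_lt i)).
have -> : #|[pred a : 'I_c | ~~ inner_col (col a)]|
  = #|[seq col a | a in [pred a : 'I_c | ~~ inner_col (col a)]]|.
  by rewrite card_image //; apply: col_inj.
rewrite -[RHS]card_ord -(card_codom (f := lastc)); last first.
  by move=> i j /(congr1 tag).
apply: eq_card => p; apply/imageP/codomP => [[a]|[i ->]].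
  rewrite inE /inner_col => out ->; exists (tag (col a)).
  by apply: col_eq => //=; move: out; case: (col a) => k [j jk] /=; lia.
have [a Ea] := col_surj (lastc i); exists a => //.
by rewrite inE Ea /inner_col /= prednK // ltnn.
Qed.

Lemma card_inner : #|[pred a : 'I_c | inner_col (col a)]| = (c - d)%N.
Proof.
have /= := cardC [pred a : 'I_c | inner_col (col a)].
have -> : #|[predC [pred a : 'I_c | inner_col (col a)]]| = d.
  by rewrite -[RHS]card_outer; apply: eq_card.
by move/(congr1 (subn^~ d)); rewrite card_ord addnK.
Qed.

Lemma card_ltn k : (k <= c)%N -> #|[pred a : 'I_c | (a < k)%N]| = k.
Proof.
move=> kc; rewrite -[RHS]card_ord -(card_codom (f := widen_ord kc)); last first.
  by move=> i j /(congr1 val) /= /val_inj.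
apply: eq_card => a; rewrite inE; apply/idP/codomP => [ak|[i ->]] //=.
by exists (Ordinal ak); apply: val_inj.
Qed.

(** The sorting puts the inner columns first, and each i contributes exactly
    one column that is not inner. *)
Lemma inner_colE a : inner_col (col a) = (a < c - d)%N.
Proof.
have mono b e : (b <= e)%N -> inner_col (col e) -> inner_col (col b).
  by move=> /col_le; rewrite /column_le; case: (inner_col (col b)) => // /[swap] ->.
apply/idP/idP => [inn|lt].
  rewrite -card_inner -(card_ltn (ltn_ord a)); apply: subset_leq_card.
  by apply/subsetP => b; rewrite !inE ltnS => ba; apply: mono inn.
apply: contraLR lt => out; rewrite -leqNgt -card_inner -(card_ltn (ltnW (ltn_ord a))).
apply: subset_leq_card; apply/subsetP => b; rewrite !inE ltnNge.
by apply: contraL => ab; apply: contra out; apply: mono.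
Qed.

Lemma pos_mu1_lt a : (pos (mu1 a) < c)%N.
Proof.
case: (posnP (tagged (mu1 a))) => [/pos0->|gt0].
  exact: leq_trans (ltn_ord _) d_le_c.
have [b Eb] := mu2_surj gt0.
have /esym Etag := congr1 tag Eb; rewrite tag_mu1 tag_mu2 in Etag.
have Ej : tagged (col a) = (tagged (col b)).+1 :> nat.
  by rewrite -tagged_mu1 Eb tagged_mu2.
have : inner_col (col b) by rewrite /inner_col -Ej Etag ltn_ord.
by rewrite inner_colE Eb pos_mu2; have := d_le_c; lia.
Qed.

Lemma pos_lt_mu1 x : (pos x < c)%N -> exists a, x = mu1 a.
Proof.
move=> xc; apply: mu1_surj; rewrite ltnNge; apply/negP => end_x.
have Ex : tagged x = n (tag x) :> nat by move: (ltn_ord (tagged x)); lia.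
have /mu2_surj[a Ea] : (0 < tagged x)%N by rewrite Ex.
have : ~~ inner_col (col a).
  rewrite /inner_col -leqNgt -tagged_mu2 -Ea Ex.
  by have /esym := congr1 tag Ea; rewrite tag_mu2 => ->.
by move: xc; rewrite inner_colE Ea pos_mu2; lia.
Qed.

Lemma pos_mu1_inner a b : (a < b)%N -> (b < c - d)%N ->
  (pos (mu1 a) < pos (mu1 b))%N.
Proof.
move=> ab bc; have ac := ltn_trans ab bc.
have : ~~ column_le (col b) (col a).
  apply: contraL ab => ba; rewrite -leqNgt leq_eqVlt.
  case: (ltnP b a) => [_|ab]; first by rewrite orbT.
  apply/orP; left; apply/eqP; congr val; apply: col_inj.
  move: ba (col_le ab); rewrite /column_le !inner_colE ac bc => P1 P2.
  apply: col_eq; [apply/val_inj|]; move: P1 P2;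
  by case: (col a) (col b) => [i [j ji]] [k [l lk]] /=; lia.
rewrite -xvar_gtE /xvar_gt !tagged_mu1 ?tag_mu1 ?tag_mu2.
rewrite /column_le !inner_colE ac bc !ltn_ord /=.
by case: (col a) (col b) => [i [j ji]] [k [l lk]] /=; lia.
Qed.

Context (n_mono : forall i j : 'I_d, (i <= j)%N -> (n i <= n j)%N).

(** The monotonicity of the n_i is used here: a larger i has its last column at
    a larger j, hence a later first-row entry, whereas the last d columns are
    sorted by decreasing i. *)
Lemma pos_mu1_outer a b : (c - d <= a)%N -> (a < b)%N ->
  (pos (mu1 b) < pos (mu1 a))%N.
Proof.
move=> ac ab; have bc : (c - d <= b)%N by lia.
have outE e : (c - d <= e)%N -> (tagged (col e)).+1 = n (tag (col e)).
  rewrite leqNgt -inner_colE /inner_col.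
  by move: (ltn_ord (tagged (col e))); lia.
have Tab : (tag (col b) < tag (col a))%N.
  have := col_le (ltnW ab); rewrite /column_le !inner_colE.
  rewrite !ltnNge ac bc /= leq_eqVlt => /orP[/eqP/val_inj T|]; last lia.
  have : col a = col b.
    by apply: col_eq => //; apply: succn_inj; rewrite !outE // T.
  by move/col_inj => E; rewrite E ltnn in ab.
rewrite -xvar_gtE /xvar_gt !tagged_mu1 ?tag_mu1 ?tag_mu2 !ltn_ord /=.
move: (n_mono (ltnW Tab)) (Tab) (outE _ ac) (outE _ bc).
by case: (col a) (col b) => [i [j ji]] [k [l lk]] /=; lia.
Qed.

Lemma bar_spec a : (a < c - d)%N -> mu1 (bar a) = mu2 a.
Proof.
rewrite -inner_colE /inner_col => inn; rewrite /bar.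
have [b Eb] := col_surj (Tagged (fun i => 'I_(n i)) (Ordinal inn)).
case: pickP => [e /andP[/eqP Et /eqP Ej]|/(_ b)] /=; last by rewrite Eb /= !eqxx.
by apply: xvar_eq; rewrite ?tagged_mu1 ?tagged_mu2 ?tag_mu1 ?tag_mu2.
Qed.

Lemma bar_gt a : (a < c - d)%N -> (a < bar a)%N.
Proof.
by move=> ac; have := pos_mu1_mu2 (bar a); rewrite bar_spec // pos_mu2; lia.
Qed.

Lemma bar_inj a b : (a < c - d)%N -> (b < c - d)%N -> bar a = bar b -> a = b.
Proof. by move=> ac bc E; apply: mu2_inj; rewrite -!bar_spec // E. Qed.

Lemma pos_mu1_bar e a : pos (mu1 e) = (d + a)%N -> (a < c - d)%N /\ e = bar a.
Proof.
move=> E; have : (a < c - d)%N by have := pos_mu1_lt e; lia.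
move=> ac; split=> //; apply: mu1_inj; apply: pos_inj.
by rewrite bar_spec // pos_mu2.
Qed.

(** A potential on the chains x_{i,0}, x_{i,1}, ...: it drops by [c - pos x]
    from the top x of a column to its bottom. That these drops get smaller as
    the position grows is what the truncated weights [nu] below rest on. *)
Definition lam x : nat :=
  (\sum_(a < c | (tag (col a) == tag x) && (tagged x <= tagged (col a)))
     (c - pos (mu1 a)))%N.

Lemma lam_mu1 a : lam (mu1 a) = (lam (mu2 a) + (c - pos (mu1 a)))%N.
Proof.
rewrite /lam (bigD1 a); last by rewrite tagged_mu1 tag_mu1 eqxx leqnn.
rewrite addnC; congr (_ + _)%N; apply: eq_bigl => b.
rewrite tagged_mu1 tagged_mu2 ?tag_mu1 ?tag_mu2.
case: (eqVneq b a) => [->|]; first by rewrite andbF ltnn andbF.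
rewrite andbT => ne; case: eqVneq => //= Et; rewrite leq_eqVlt.
case: eqVneq => //= Ej; case/eqP: ne.
by apply: col_inj; apply: col_eq.
Qed.

End Positions.

(** * Generated ideals *)

Section IdealGen.
Context (A : comNzRingType).
Implicit Types (G H : A -> Prop) (f g : A).

Lemma ideal_gen0 G : ideal_gen G 0.
Proof. by exists [::]; rewrite ?big_nil. Qed.

Lemma ideal_gen_mem G g : G g -> ideal_gen G g.
Proof.
move=> Gg; exists [:: (1, g)]; last by rewrite big_seq1 mul1r.
by move=> p; rewrite inE => /eqP ->.
Qed.

Lemma ideal_genD G f g : ideal_gen G f -> ideal_gen G g -> ideal_gen G (f + g).
Proof.
move=> [s Gs ->] [t Gt ->]; exists (s ++ t); last by rewrite big_cat.
by move=> p; rewrite mem_cat => /orP[/Gs|/Gt].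
Qed.

Lemma ideal_genM G f g : ideal_gen G g -> ideal_gen G (f * g).
Proof.
move=> [s Gs ->]; exists [seq (f * p.1, p.2) | p <- s].
  by move=> p /mapP[q /Gs Gq ->].
by rewrite big_map mulr_sumr; apply: eq_bigr => p _; rewrite mulrA.
Qed.

Lemma ideal_gen_sub G H : (forall g, G g -> ideal_gen H g) ->
  forall f, ideal_gen G f -> ideal_gen H f.
Proof.
move=> GH f [s Gs ->]; rewrite big_seq.
apply: big_ind => [||p ps].
- exact: ideal_gen0.
- exact: ideal_genD.
- exact/ideal_genM/GH/Gs.
Qed.

End IdealGen.

(** * Supports *)

Section Supports.
Context (K : fieldType) (N : nat).
Implicit Types (p q : {mpoly K[N]}) (m : 'X_{1..N}) (P Q : 'X_{1..N} -> Prop).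

Definition supp_in P p : Prop := forall m, m \in msupp p -> P m.

Lemma supp_inD P p q : supp_in P p -> supp_in P q -> supp_in P (p + q).
Proof. by move=> Pp Pq m /msuppD_le; rewrite mem_cat => /orP[/Pp|/Pq]. Qed.

Lemma supp_inN P p : supp_in P p -> supp_in P (- p).
Proof. by move=> Pp m; rewrite (perm_mem (msuppN p)) => /Pp. Qed.

Lemma supp_inX P m : P m -> supp_in P 'X_[m].
Proof. by move=> Pm k; rewrite msuppX inE => /eqP ->. Qed.

Lemma supp_inZ P a p : supp_in P p -> supp_in P (a *: p).
Proof. by move=> Pp m /msuppZ_le /Pp. Qed.

Lemma supp_inM P Q (S : 'X_{1..N} -> Prop) p q :
    (forall m k, P m -> Q k -> S (m + k)%MM) ->
  supp_in P p -> supp_in Q q -> supp_in S (p * q).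
Proof.
by move=> PQS Pp Qq m /msuppM_le /allpairsP[[k l] /= [/Pp Pk /Qq Ql ->]]; apply: PQS.
Qed.

Context (lt : rel 'X_{1..N}).

(** Stronger than [is_lead] only in that it displays the tail, which is what
    products need. *)
Definition lead_form p m : Prop :=
  exists k r, [/\ k != 0, p = k *: 'X_[m] + r & supp_in (fun u => lt u m) r].

Lemma lead_form_is_lead p m : irreflexive lt -> lead_form p m -> is_lead lt p m.
Proof.
move=> lt_irr [k [r [k0 -> Hr]]]; split=> [|m' /msuppD_le].
  have rm : r@_m = 0 by apply: memN_msupp_eq0; apply: contraFN (lt_irr m) => /Hr.
  by rewrite mcoeff_msupp mcoeffD mcoeffZ mcoeffX eqxx mulr1 rm addr0.
rewrite mem_cat => /orP[/msuppZ_le|/Hr //].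
by rewrite msuppX inE => /eqP ->; rewrite eqxx.
Qed.

Lemma lead_form1 : lead_form 1 0%MM.
Proof.
exists 1, 0; rewrite oner_neq0 mpolyX0 scale1r addr0.
by split=> // m; rewrite msupp0.
Qed.

Lemma lead_formM p q m k : transitive lt ->
    (forall l m k, lt m k -> lt (l + m)%MM (l + k)%MM) ->
  lead_form p m -> lead_form q k -> lead_form (p * q) (m + k).
Proof.
move=> lt_trans lt_add [a [r [a0 -> Hr]]] [b [s [b0 -> Hs]]].
exists (a * b), (r * (b *: 'X_[k] + s) + a *: 'X_[m] * s).
have lt_add' l u v : lt u v -> lt (u + l)%MM (v + l)%MM.
  by rewrite ![(_ + l)%MM]addmC; apply: lt_add.
split; first by rewrite mulf_neq0.
  rewrite mulrDl [a *: 'X_[m] * (_ + _)]mulrDr -addrA; congr (_ + _).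
    by rewrite -scalerAl -scalerAr scalerA mpolyXD.
  by rewrite addrC.
apply: supp_inD.
  rewrite mulrDr; apply: supp_inD.
    apply: (supp_inM (Q := eq k)) Hr _ => [u _ lt_u <-|]; first exact: lt_add'.
    by apply: supp_inZ; apply: supp_inX.
  apply: supp_inM Hr Hs => u v lt_u lt_v.
  exact: lt_trans (lt_add' _ _ _ lt_u) (lt_add _ _ _ lt_v).
apply: (supp_inM (P := eq m)) Hs => [_ v <- lt_v|]; first exact: lt_add.
by apply: supp_inZ; apply: supp_inX.
Qed.

End Supports.

(** * Groebner bases from linearly independent standard monomials *)

Section Criterion.
Context (K : fieldType) (N D : nat) (lt : rel 'X_{1..N}).
Context (lt_irr : irreflexive lt) (lt_trans : transitive lt).
Context (lt_add : forall k m m' : 'X_{1..N}, lt m m' -> lt (k + m)%MM (k + m')%MM).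
Implicit Types (f g h r : {mpoly K[N]}) (m k : 'X_{1..N}).

Lemma is_lead_uniq f m m' : is_lead lt f m -> is_lead lt f m' -> m = m'.
Proof.
move=> [mf Hm] [mf' Hm']; apply/eqP; case: eqVneq => // ne.
have := lt_trans (Hm' _ mf ne); rewrite eq_sym in ne.
by move=> /(_ _ (Hm _ mf' ne)); rewrite lt_irr.
Qed.

Context (G J : {mpoly K[N]} -> Prop) (std : 'X_{1..N} -> Prop).
Context (G_lead : forall g, G g -> exists m, is_lead lt g m).
Context (G_homog : forall g m, G g -> m \in msupp g -> mdeg m = D).
Context (std_or_div : forall m,
  std m \/ exists g l, [/\ G g, is_lead lt g l & (l <= m)%MM]).

(** [below] records how the monomials of the remainder compare with the
    monomials that were reduced. *)
Definition reducible_to (below : 'X_{1..N} -> Prop) h : Prop :=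
  exists2 r, ideal_gen G (h - r) & forall m, m \in msupp r -> std m /\ below m.

Lemma reducible_to_sum below h :
    (forall m, m \in msupp h -> reducible_to below 'X_[m]) ->
  reducible_to below h.
Proof.
move=> red; rewrite [h]mpolyE big_seq; apply: big_ind.
- by exists 0; rewrite ?subrr ?msupp0 //; apply: ideal_gen0.
- move=> p q [r Gr Hr] [s Gs Hs]; exists (r + s).
    by rewrite opprD addrACA; apply: ideal_genD.
  by move=> m /msuppD_le; rewrite mem_cat => /orP[/Hr|/Hs].
move=> m /red[r Gr Hr]; exists (h@_m *: r).
  by rewrite -scalerBr -mul_mpolyC; apply: ideal_genM.
by move=> m' /msuppZ_le /Hr.
Qed.

(** Reduction of a monomial stays in its degree, where only finitely many
    monomials are smaller. *)
Lemma reducible_monomial m : reducible_to (fun m' => m' = m \/ lt m' m) 'X_[m].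
Proof.
have [w] := ubnP #|[pred m' : 'X_{1..N < (mdeg m).+1} | lt m' m]|.
elim: w m => // w IH m le_w.
case: (std_or_div m) => [stdm|[g [l [Gg [lg Hl] lm]]]].
  exists 'X_[m]; first by rewrite subrr; apply: ideal_gen0.
  by move=> m'; rewrite msuppX inE => /eqP ->; split=> //; left.
have gl0 : g@_l != 0 by rewrite -mcoeff_msupp.
pose h : {mpoly K[N]} := 'X_[m] - (g@_l)^-1 *: ('X_[m - l] * g).
have supp_h m' : m' \in msupp h -> lt m' m /\ mdeg m' = mdeg m.
  have -> : h = - (g@_l)^-1 *: ((g - g@_l *: 'X_[l]) * 'X_[m - l]).
    rewrite mulrBl -scalerAl -mpolyXD addmC submK // scalerBr scalerA.
    by rewrite mulNr mulVf // scaleN1r opprK scaleNr addrC /h mulrC.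
  move/msuppZ_le; rewrite (perm_mem (msuppMX _ _)) => /mapP[k kg ->].
  have kl : k != l.
    apply: contraTneq kg => ->; rewrite mcoeff_msupp mcoeffB mcoeffZ mcoeffX.
    by rewrite eqxx mulr1 subrr eqxx.
  have {}kg : k \in msupp g.
    move: kg; rewrite !mcoeff_msupp mcoeffB mcoeffZ mcoeffX (eq_sym l) (negPf kl).
    by rewrite mulr0 subr0.
  rewrite -{2 4}(submK lm) addmC; split; last first.
    by rewrite !mdegD (G_homog Gg kg) (G_homog Gg lg) addnC.
  by rewrite addmC; apply/lt_add/Hl.
have [r Gr Hr] : reducible_to (fun m' => m' = m \/ lt m' m) h.
  apply: reducible_to_sum => m' /supp_h[lt' deg'].
  have [|r Gr Hr] := IH m'.
    rewrite -ltnS; apply: leq_trans le_w; rewrite deg' ltnS.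
    apply: proper_card; apply/properP; split.
      apply/subsetP => k; rewrite !inE => /lt_trans; exact.
    have lm' : (mdeg m' < (mdeg m).+1)%N by rewrite deg'.
    by exists (BMultinom lm'); rewrite inE ?lt_irr.
  exists r => // k /Hr[stdk [E | lek]]; [subst k|]; split=> //; right=> //.
  exact: lt_trans lek lt'.
exists r => //; have -> : 'X_[m] - r = (h - r) + (g@_l)^-1 *: ('X_[m - l] * g).
  by rewrite addrAC subrK.
apply: ideal_genD => //; rewrite scalerAl; apply: ideal_genM.
exact: ideal_gen_mem.
Qed.

Lemma normal_form h :
  reducible_to (fun m => exists2 m', m' \in msupp h & m = m' \/ lt m m') h.
Proof.
apply: reducible_to_sum => m mh; have [r Gr Hr] := reducible_monomial m.
by exists r => // k /Hr[stdk Hk]; split=> //; exists m.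
Qed.

Context (J0 : J 0) (JD : forall f g, J f -> J g -> J (f + g)).
Context (JM : forall f g, J g -> J (f * g)).
Context (GJ : forall g, G g -> J g).
Context (std_indep : forall r,
  J r -> (forall m, m \in msupp r -> std m) -> r = 0).

Lemma ideal_gen_J f : ideal_gen G f -> J f.
Proof.
move=> [s Gs ->]; rewrite big_seq; apply: big_ind => // p ps.
exact/JM/GJ/Gs.
Qed.

Lemma J_sub f g : J f -> J g -> J (f - g).
Proof. by move=> Jf Jg; rewrite -mulN1r; apply: JD => //; apply: JM. Qed.

(** The remainder of an element of J is a standard element of J, hence 0. *)
Lemma criterion_generates : generates G J.
Proof.
move=> f; split=> [Jf|]; last exact: ideal_gen_J.
have [r Gr Hr] := normal_form f.
suff r0 : r = 0 by rewrite -[f]subr0 -r0.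
apply: std_indep => [|m /Hr[] //].
by rewrite -[r](subKr f); apply: J_sub => //; apply: ideal_gen_J.
Qed.

(** If the leading monomial of an element of J were standard, reducing the
    other terms would give a nonzero standard element of J. *)
Lemma lead_not_std f m : J f -> is_lead lt f m -> ~ std m.
Proof.
move=> Jf [mf Hm] stdm; pose t := f - f@_m *: 'X_[m].
have supp_t k : k \in msupp t -> lt k m.
  rewrite mcoeff_msupp /t mcoeffB mcoeffZ mcoeffX.
  case: (eqVneq m k) => [->|ne]; first by rewrite mulr1 subrr eqxx.
  by rewrite mulr0 subr0 -mcoeff_msupp => kf; apply: Hm; rewrite // eq_sym.
have [r Gr Hr] := normal_form t.
have supp_r k : k \in msupp r -> lt k m.
  by move=> /Hr[_ /= [k' /supp_t k'm [->|/lt_trans]]] //; apply.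
have /std_indep r0 : J (f@_m *: 'X_[m] + r).
  have -> : f@_m *: 'X_[m] + r = f - (t - r).
    by rewrite /t opprB addrCA subKr addrC.
  by apply: J_sub => //; apply: ideal_gen_J.
have : (f@_m *: 'X_[m] + r)@_m = 0.
  rewrite r0 ?mcoeff0 // => k /msuppD_le; rewrite mem_cat.
  by case/orP => [/msuppZ_le|/Hr[] //]; rewrite msuppX inE => /eqP ->.
have rm : r@_m = 0.
  by apply/memN_msupp_eq0; apply: contraFN (lt_irr m) => /supp_r.
by rewrite mcoeffD mcoeffZ mcoeffX eqxx mulr1 rm addr0 => /eqP; rewrite mcoeff_eq0 mf.
Qed.

Lemma criterion_groebner : groebner_basis lt G J.
Proof.
split=> // f; split; apply: ideal_gen_sub => u.
- move=> [h [m [Jh lead_h ->]]]; case: (std_or_div m) => [/(lead_not_std Jh)|].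
    by move=> /(_ lead_h).
  move=> [g [l [Gg lead_g lm]]]; rewrite -(submK lm) mpolyXD.
  by apply/ideal_genM/ideal_gen_mem; exists g, l.
- move=> [g [m [Gg lead_g ->]]]; apply: ideal_gen_mem; exists g, m.
  by split=> //; apply: GJ.
Qed.

(** * Minimality *)

Lemma mcoeffM_homog g h m : (forall k, k \in msupp h -> mdeg k = D) ->
  mdeg m = D -> (g * h)@_m = g@_0%MM * h@_m.
Proof.
move=> homh dm; have gX0 k : k \in msupp h -> k != m -> (g * 'X_[k])@_m = 0.
  move=> /homh dk km; apply: memN_msupp_eq0.
  rewrite (perm_mem (msuppMX _ _)); apply/mapP => -[l _ E].
  have l0 : l = 0%MM.
    by apply/eqP; rewrite -mdeg_eq0 -(eqn_add2l (mdeg k)) -mdegD -E dm dk addn0.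
  by rewrite E l0 addm0 eqxx in km.
rewrite {1}[h]mpolyE mulr_sumr linear_sum /=.
case: (boolP (m \in msupp h)) => mh; last first.
  rewrite (memN_msupp_eq0 mh) mulr0 big_seq big1 // => k kh.
  rewrite -scalerAr mcoeffZ gX0 ?mulr0 //.
  by apply: contraNneq mh => <-.
rewrite (bigD1_seq m) ?msupp_uniq //= big_seq_cond big1 ?addr0.
  have := mcoeffMX g m 0%MM; rewrite addm0 => gX.
  by rewrite -scalerAr mcoeffZ gX mulrC.
by move=> k /andP[kh km]; rewrite -scalerAr mcoeffZ gX0 ?mulr0.
Qed.

Lemma max_lead (s : seq {mpoly K[N]}) : s != [::] ->
    (forall h, h \in s -> exists m, is_lead lt h m) ->
  exists h m, [/\ h \in s, is_lead lt h m
    & forall h' m', h' \in s -> is_lead lt h' m' -> ~~ lt m m'].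
Proof.
elim: s => // h s IH _ lead_s; have [m lead_h] := lead_s h (mem_head _ _).
case: (eqVneq s [::]) => [s0|/IH[]].
  exists h, m; split=> [|//|h' m']; rewrite ?mem_head // s0 inE => /eqP ->.
  by move/(is_lead_uniq lead_h) => <-; rewrite lt_irr.
  by move=> h' h's; apply: lead_s; rewrite inE h's orbT.
move=> h0 [m0 [h0s lead_h0 max0]].
case: (boolP (lt m0 m)) => mm0.
  exists h, m; split=> [|//|h' m']; rewrite ?mem_head // inE => /orP[/eqP ->|].
    by move/(is_lead_uniq lead_h) => <-; rewrite lt_irr.
  by move=> h's /max0 => /(_ h's); apply: contra => /(lt_trans mm0).
exists h0, m0; split=> [|//|h' m']; first by rewrite inE h0s orbT.
rewrite inE => /orP[/eqP ->|]; last exact: max0.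
by move/(is_lead_uniq lead_h) => <-.
Qed.

Context (lead_inj : forall g h m,
  G g -> G h -> is_lead lt g m -> is_lead lt h m -> g = h).

(** Among the terms with a nonzero coefficient, the largest leading monomial
    cannot be cancelled by the others. *)
Lemma lead_free (s : seq {mpoly K[N]}) (a : {mpoly K[N]} -> K) :
    uniq s -> (forall h, h \in s -> G h) ->
    (forall m, mdeg m = D -> \sum_(h <- s) a h * h@_m = 0) ->
  forall h, h \in s -> a h = 0.
Proof.
move=> uniq_s Gs sum0 h hs; apply/eqP; apply: contraTT isT => ah0.
have [||h0 [m [+ [mh0 Hm] maxm]]] := @max_lead [seq g <- s | a g != 0].
- by apply: contraTneq hs => /(congr1 (mem^~ h)); rewrite /= mem_filter ah0 /= => ->.
- by move=> g; rewrite mem_filter => /andP[_ /Gs/G_lead].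
rewrite mem_filter => /andP[a0 h0s].
have := sum0 m (G_homog (Gs _ h0s) mh0).
rewrite (bigD1_seq h0) //= big_seq_cond big1 ?addr0 => [|g /andP[gs gh0]].
  by move/eqP; rewrite mulf_eq0 (negPf a0) mcoeff_eq0 mh0.
case: (eqVneq (a g) 0) => [->|ag]; first by rewrite mul0r.
rewrite memN_msupp_eq0 ?mulr0 //; apply/negP => mg.
have [m' lead_g] := G_lead (Gs _ gs).
have := maxm g m' _ lead_g; rewrite mem_filter ag gs => /(_ isT).
case: (eqVneq m m') => [E|ne]; last by case: (lead_g) => _ /(_ _ mg ne) ->.
by rewrite (lead_inj (Gs _ gs) (Gs _ h0s) lead_g) ?E ?eqxx // -?E in gh0.
Qed.

(** In degree D an ideal relation between generators is a linear relation over
    the field, and generators with distinct leading monomials are linearly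
    independent. *)
Lemma criterion_minimal : minimal_generators G J.
Proof.
split=> [|H HG genH g Gg]; first exact: criterion_generates.
have /genH[s Hs Eg] : J g by apply: GJ.
case: (boolP (g \in [seq p.2 | p <- s])) => [/mapP[p /Hs ? ->] //|gs].
pose a h := \sum_(p <- s | p.2 == h) p.1@_0%MM - (g == h)%:R.
have Es m : mdeg m = D -> g@_m = \sum_(p <- s) p.1@_0%MM * p.2@_m.
  move=> dm; rewrite {1}Eg linear_sum /= big_seq [RHS]big_seq.
  apply: eq_bigr => p /Hs/HG Gp; apply: mcoeffM_homog => // k; exact: G_homog.
have pick_h (h : {mpoly K[N]}) (F : {mpoly K[N]} -> K) (U : seq {mpoly K[N]}) :
  uniq U -> h \in U -> \sum_(h' <- U | h == h') F h' = F h.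
  move=> Uu hU; rewrite big_mkcond (bigD1_seq h) //= eqxx big1 ?addr0 // => h'.
  by rewrite eq_sym => /negPf ->.
pose U := undup (g :: [seq p.2 | p <- s]).
have Uu : uniq U by apply: undup_uniq.
have gU : g \in U by rewrite mem_undup mem_head.
have GU h : h \in U -> G h.
  by rewrite mem_undup inE => /orP[/eqP -> //|/mapP[p /Hs/HG ? ->] //].
have sum0 m : mdeg m = D -> \sum_(h <- U) a h * h@_m = 0.
  move=> dm; under eq_bigr do rewrite mulrBl mulr_suml.
  rewrite sumrB (exchange_big_dep predT) //=; apply/eqP; rewrite subr_eq0.
  apply/eqP; transitivity (g@_m).
    rewrite Es // big_seq [RHS]big_seq; apply: eq_bigr => p ps.
    by apply: pick_h => //; rewrite mem_undup inE map_f ?orbT.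
  rewrite -(pick_h g (fun h => h@_m) U) // big_mkcond /=.
  by apply: eq_bigr => h _; case: eqVneq; rewrite ?mul1r ?mul0r.
have := lead_free Uu GU sum0 gU; rewrite /a eqxx big_seq_cond big1.
  by move/eqP; rewrite sub0r oppr_eq0 oner_eq0.
by move=> p /andP[ps /eqP Ep]; rewrite -Ep map_f in gs.
Qed.

End Criterion.

(** * The term order *)

Section Lexlt.
Context (I : finType) (gt : rel I).
Implicit Types (u v w : I -> nat).

Lemma lexltP u w :
  reflect (exists2 i, (u i < w i)%N & forall j, gt j i -> u j = w j)
          (lexlt gt u w).
Proof.
apply: (iffP existsP) => [[i /andP[ui /forallP H]]|[i ui H]]; exists i => //.
  by move=> j /(implyP (H j)) /eqP.
by rewrite ui; apply/forallP => j; apply/implyP => /H ->.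
Qed.

Lemma lexlt_irr u : lexlt gt u u = false.
Proof. by apply/lexltP => -[i]; rewrite ltnn. Qed.

Lemma eq_lexlt u u' w w' : u =1 u' -> w =1 w' -> lexlt gt u w = lexlt gt u' w'.
Proof.
move=> Eu Ew; apply: eq_existsb => i; rewrite Eu Ew; congr (_ && _).
by apply: eq_forallb => j; rewrite Eu Ew.
Qed.

Lemma lexlt_add v u w :
  lexlt gt u w -> lexlt gt (fun i => v i + u i)%N (fun i => v i + w i)%N.
Proof.
move=> /lexltP[i ui H]; apply/lexltP; exists i; first by rewrite ltn_add2l.
by move=> j /H ->.
Qed.

Context (gt_trans : transitive gt).
Context (gt_total : forall i j, i != j -> gt i j || gt j i).

Lemma lexlt_trans u v w : lexlt gt u v -> lexlt gt v w -> lexlt gt u w.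
Proof.
move=> /lexltP[i ui Hi] /lexltP[j vj Hj]; apply/lexltP.
case: (eqVneq i j) => [E|/gt_total/orP[ij|ji]].
- subst j; exists i; first exact: ltn_trans vj.
  by move=> k ki; rewrite Hi ?Hj.
- exists i; first by rewrite -Hj.
  by move=> k ki; rewrite Hi // Hj //; apply: gt_trans ij.
- exists j; first by rewrite Hi.
  by move=> k kj; rewrite Hi ?Hj //; apply: gt_trans ji.
Qed.

End Lexlt.

Section TermOrder.
Context (d : nat) (n : 'I_d -> nat).
Context (n_gt0 : forall i : 'I_d, (1 <= n i)%N).
Local Notation c := (ncols n).
Local Notation mon := 'X_{1..#|var n|}.
Implicit Types (a b g e s t : 'I_c) (x y : xvar n) (u : tvar n) (v w : var n).
Implicit Types (m : mon).

Lemma tvar_eq u u' : (val u).1 = (val u').1 :> nat ->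
  (val u).2 = (val u').2 :> nat -> u = u'.
Proof.
case: u u' => [[a b] ab] [[g e] ge] /= /val_inj E1 /val_inj E2.
by apply: val_inj; rewrite /= E1 E2.
Qed.

Lemma var_gt_trans : transitive (@var_gt d n).
Proof.
move=> [x|u] [y|u'] [z|w] //=; rewrite ?xvar_gtE //; first exact: ltn_trans.
by rewrite /tvar_gt -!val_eqE /=; lia.
Qed.

Lemma var_gt_total v w : v != w -> var_gt v w || var_gt w v.
Proof.
case: v w => [x|u] [y|w] //= ne; first exact: xvar_gt_total.
rewrite /tvar_gt -!val_eqE /=; case: (ltngtP (val u).1 (val w).1) => //= E1.
case: (ltngtP (val u).2 (val w).2) => //= E2.
by case/eqP: ne; rewrite (tvar_eq E1 E2).
Qed.

Lemma mon_mdegD m m' k : mon_mdeg (m + m') k = (mon_mdeg m k + mon_mdeg m' k)%N.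
Proof.
by rewrite /mon_mdeg -big_split /=; apply: eq_bigr => i _; rewrite mnmDE mulnDl.
Qed.

Lemma mon_sdegD m m' : mon_sdeg (m + m') = (mon_sdeg m + mon_sdeg m')%N.
Proof.
by rewrite /mon_sdeg -big_split /=; apply: eq_bigr => i _; rewrite mnmDE mulnDl.
Qed.

Lemma sum_mnmU v (F : 'I_#|var n| -> nat) :
  (\sum_i U_(enum_rank v)%MM i * F i)%N = F (enum_rank v).
Proof.
rewrite (bigD1 (enum_rank v)) //= big1 ?addn0 => [|i ne].
  by rewrite mnm1E eqxx mul1n.
by rewrite mnm1E eq_sym (negPf ne) mul0n.
Qed.

Lemma mon_mdegU v k : mon_mdeg U_(enum_rank v) k = var_mdeg v k.
Proof. by rewrite /mon_mdeg sum_mnmU enum_rankK. Qed.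

Lemma mon_sdegU v : mon_sdeg U_(enum_rank v) = var_sdeg v.
Proof. by rewrite /mon_sdeg sum_mnmU enum_rankK. Qed.

Lemma mon_lt_irr : irreflexive (@mon_lt d n).
Proof. by move=> m; rewrite /mon_lt !(lexlt_irr, ltnn, andbF). Qed.

Lemma mon_lt_trans : transitive (@mon_lt d n).
Proof.
move=> m2 m1 m3; rewrite /mon_lt.
have mtot (i j : 'I_(d + c)) : i != j -> (i < j)%N || (j < i)%N.
  by rewrite -neq_ltn.
have mtr : transitive (fun k l : 'I_(d + c) => (k < l)%N).
  by move=> ? ? ?; apply: ltn_trans.
have vtr : transitive (fun i j : 'I_#|var n| => var_gt (enum_val i) (enum_val j)).
  by move=> ? ? ?; apply: var_gt_trans.
have vtot (i j : 'I_#|var n|) : i != j ->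
  var_gt (enum_val i) (enum_val j) || var_gt (enum_val j) (enum_val i).
  by move=> ij; apply: var_gt_total; rewrite (inj_eq enum_val_inj).
case/orP=> [lt12|/andP[/forallP E12 H12]] /orP[lt23|/andP[/forallP E23 H23]].
- by rewrite (lexlt_trans mtr mtot lt12 lt23).
- have E k : mon_mdeg m2 k = mon_mdeg m3 k by apply/eqP.
  by rewrite -(eq_lexlt _ (frefl (mon_mdeg m1)) E) lt12.
- have E k : mon_mdeg m1 k = mon_mdeg m2 k by apply/eqP.
  by rewrite (eq_lexlt _ E (frefl (mon_mdeg m3))) lt23.
apply/orP; right; apply/andP; split.
  by apply/forallP => k; rewrite (eqP (E12 k)).
case/orP: H12 => [lt12|/andP[/eqP-> lt12]]; case/orP: H23 => [lt23|/andP[/eqP<- lt23]].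
- by rewrite (ltn_trans lt12 lt23).
- by rewrite lt12.
- by rewrite lt23.
- by rewrite eqxx (lexlt_trans vtr vtot lt12 lt23) orbT.
Qed.

Lemma mon_lt_add (k m m' : mon) : mon_lt m m' -> mon_lt (k + m)%MM (k + m')%MM.
Proof.
have E p q l : mon_mdeg (p + q) l = (mon_mdeg p l + mon_mdeg q l)%N := mon_mdegD p q l.
rewrite /mon_lt => /orP[lt|/andP[/forallP Em Hs]].
  by rewrite (eq_lexlt _ (E k m) (E k m')) lexlt_add.
apply/orP; right; apply/andP; split.
  by apply/forallP => l; rewrite !mon_mdegD (eqP (Em l)).
rewrite !mon_sdegD ltn_add2l eqn_add2l; case/orP: Hs => [->//|/andP[->]] lt.
rewrite (eq_lexlt _ (fun i => mnmDE i k m) (fun i => mnmDE i k m')).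
by rewrite lexlt_add // orbT.
Qed.

Lemma mon_lt_mdeg m m' p : (p < d + c)%N ->
    (forall k : 'I_(d + c), k = p :> nat -> (mon_mdeg m k < mon_mdeg m' k)%N) ->
    (forall k : 'I_(d + c), (k < p)%N -> mon_mdeg m k = mon_mdeg m' k) ->
  mon_lt m m'.
Proof.
move=> pdc lt_p eq_p; apply/orP; left; apply/lexltP.
by exists (Ordinal pdc) => [|j /eq_p //]; apply: lt_p.
Qed.

Lemma mon_lt_sdeg m m' : mon_mdeg m =1 mon_mdeg m' ->
  (mon_sdeg m < mon_sdeg m')%N -> mon_lt m m'.
Proof.
move=> E lt; apply/orP; right; rewrite lt andbT.
by apply/forallP => k; rewrite E.
Qed.

Lemma mon_lt_lex m m' v : mon_mdeg m =1 mon_mdeg m' ->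
    mon_sdeg m = mon_sdeg m' -> (m (enum_rank v) < m' (enum_rank v))%N ->
    (forall w, var_gt w v -> m (enum_rank w) = m' (enum_rank w)) ->
  mon_lt m m'.
Proof.
move=> E Es lt H; apply/orP; right; rewrite Es eqxx ltnn /=.
apply/andP; split; first by apply/forallP => k; rewrite E.
apply/lexltP; exists (enum_rank v) => // j; rewrite enum_rankK => /H.
by rewrite enum_valK.
Qed.

(** * Monomials of degree one *)

Definition xmon x : mon := U_(enum_rank (inl x : var n))%MM.

Definition tmon a b : mon :=
  if insub (a, b) is Some u then U_(enum_rank (inr u : var n))%MM
  else if insub (b, a) is Some u then U_(enum_rank (inr u : var n))%MM
  else 0%MM.

Lemma tmonC a b : tmon a b = tmon b a.
Proof. by rewrite /tmon; do 2![case: insubP => //=]; move=> u ? _ v; lia. Qed.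

Lemma tmonE a b (ab : (a < b)%N) :
  tmon a b = U_(enum_rank (inr (exist _ (a, b) ab) : var n))%MM.
Proof.
rewrite /tmon; case: insubP => [u _ Eu|]; last by rewrite /= ab.
by congr (U_(enum_rank (inr _)))%MM; apply: val_inj.
Qed.

Lemma tmonP a b : a != b -> exists s t (st : (s < t)%N),
  [/\ tmon a b = U_(enum_rank (inr (exist _ (s, t) st) : var n))%MM,
      minn a b = s & maxn a b = t].
Proof.
case: (ltngtP a b) => [ab|ba|/val_inj->] ne; last by rewrite eqxx in ne.
  by exists a, b, ab; rewrite (tmonE ab).
by exists b, a, ba; rewrite tmonC (tmonE ba).
Qed.

Lemma mdeg_tmon a b : a != b -> mdeg (tmon a b) = 1%N.
Proof. by move=> /tmonP[s [t [st [-> _ _]]]]; rewrite mdeg1. Qed.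

Lemma mdeg_xmon x : mdeg (xmon x) = 1%N. Proof. exact: mdeg1. Qed.

Lemma mon_mdeg_tmon a b k : a != b ->
  mon_mdeg (tmon a b) k = ((d + a == k) + (d + b == k))%N.
Proof.
move=> /tmonP[s [t [st [-> Es Et]]]].
rewrite mon_mdegU /var_mdeg /= mnmDE !mnm1E -!val_eqE /=.
by rewrite -Es -Et; lia.
Qed.

Lemma mon_mdeg_xmon x k : mon_mdeg (xmon x) k = (pos x == k).
Proof. by rewrite mon_mdegU mdeg_xE. Qed.

Lemma mon_sdeg_tmon a b : (a < b)%N -> mon_sdeg (tmon a b) = (c - a.+1)%N.
Proof. by move=> ab; rewrite (tmonE ab) mon_sdegU. Qed.

Lemma mon_sdeg_xmon x : mon_sdeg (xmon x) = 0%N.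
Proof. by rewrite mon_sdegU. Qed.

Lemma tmon_inl a b x : tmon a b (enum_rank (inl x : var n)) = 0%N.
Proof.
case: (eqVneq a b) => [->|/tmonP[s [t [st [-> _ _]]]]].
  by rewrite /tmon !insubF /= ?ltnn // mnm0E.
by rewrite mnm1E (inj_eq enum_rank_inj).
Qed.

Lemma tmon_inr a b u : a != b -> tmon a b (enum_rank (inr u : var n)) =
  ((minn a b == (val u).1) && (maxn a b == (val u).2)).
Proof.
move=> /tmonP[s [t [st [-> -> ->]]]]; rewrite mnm1E (inj_eq enum_rank_inj).
by case: u => [[s' t'] st'].
Qed.

Lemma xmon_inl x y : xmon x (enum_rank (inl y : var n)) = (x == y).
Proof. by rewrite mnm1E (inj_eq enum_rank_inj). Qed.

Lemma xmon_inr x u : xmon x (enum_rank (inr u : var n)) = 0%N.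
Proof. by rewrite mnm1E (inj_eq enum_rank_inj). Qed.

End TermOrder.

(** * Leading monomials of the generators *)

Section Leads.
Context (K : fieldType) (d : nat) (n : 'I_d -> nat).
Context (n_gt0 : forall i : 'I_d, (1 <= n i)%N).
Context (n_mono : forall i j : 'I_d, (i <= j)%N -> (n i <= n j)%N).
Local Notation c := (ncols n).
Local Notation mon := 'X_{1..#|var n|}.
Local Notation S := {mpoly K[#|var n|]}.
Implicit Types (a b g e s t : 'I_c) (x y : xvar n) (m : mon).

Lemma T_lt a b : (a < b)%N -> T K a b = 'X_[tmon a b] :> S.
Proof.
move=> ab; rewrite (tmonE ab) /T; case: insubP => [u _ Eu|]; last by rewrite /= ab.
by congr ('X_(enum_rank (inr _))); apply: val_inj.
Qed.

Lemma T_anti a b : T K b a = - T K a b.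
Proof.
case: (ltngtP a b) => [ab|ba|/val_inj ->].
- rewrite /T; case: insubP => /= [u|_]; first by move=> ? Eu; lia.
  by case: insubP => //=; rewrite ab.
- rewrite [in RHS]/T; case: insubP => /= [u|_]; first by move=> ? Eu; lia.
  rewrite /T; case: insubP => //= [u _ _|]; by rewrite ?opprK ?ba.
- by rewrite /T !insubF /= ?ltnn // oppr0.
Qed.

Lemma T_neq a b : a != b -> exists2 k : K, k != 0 & T K a b = k *: 'X_[tmon a b].
Proof.
rewrite neq_ltn => /orP[ab|ba].
  by exists 1; rewrite ?oner_neq0 // T_lt // scale1r.
exists (-1); first by rewrite oppr_eq0 oner_neq0.
by rewrite T_anti T_lt // scaleN1r tmonC.
Qed.

Definition below m : S -> Prop := supp_in (fun u => mon_lt u m /\ mdeg u = 2%N).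

(** A leading term together with the fact that the polynomial is quadratic. *)
Definition leads (f : S) m : Prop :=
  exists k r, [/\ k != 0, f = k *: 'X_[m] + r, below m r & mdeg m = 2%N].

Lemma belowD m r r' : below m r -> below m r' -> below m (r + r').
Proof. exact: supp_inD. Qed.

Lemma belowN m r : below m r -> below m (- r).
Proof. exact: supp_inN. Qed.

Lemma belowZ m k r : below m r -> below m (k *: r).
Proof. exact: supp_inZ. Qed.

Lemma belowX m m' : mon_lt m' m -> mdeg m' = 2%N -> below m 'X_[m'].
Proof. by move=> lt dm; apply: supp_inX. Qed.

Lemma leads_is_lead f m : leads f m -> is_lead (@mon_lt d n) f m.
Proof.
move=> [k [r [k0 -> Hr _]]]; apply: (lead_form_is_lead (@mon_lt_irr d n)).
by exists k, r; split=> // u /Hr[].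
Qed.

Lemma leads_homog f m m' : leads f m -> m' \in msupp f -> mdeg m' = 2%N.
Proof.
move=> [k [r [k0 -> Hr dm]]] /msuppD_le; rewrite mem_cat.
by case/orP=> [/msuppZ_le|/Hr[] //]; rewrite msuppX inE => /eqP ->.
Qed.

Lemma XST x a b : (a < b)%N -> XS K x * T K a b = 'X_[xmon x + tmon a b] :> S.
Proof. by move=> ab; rewrite T_lt // /XS -mpolyXD. Qed.

Lemma TT a b g e : (a < b)%N -> (g < e)%N ->
  T K a b * T K g e = 'X_[tmon a b + tmon g e] :> S.
Proof. by move=> ab ge; rewrite !T_lt // -mpolyXD. Qed.

Lemma neq_lt a b : (a < b)%N -> a != b.
Proof. by rewrite neq_ltn => ->. Qed.

Lemma lt_dc a : (d + a < d + c)%N.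
Proof. by rewrite ltn_add2l. Qed.

Lemma mdeg_xt x a b : a != b -> mdeg (xmon x + tmon a b) = 2%N.
Proof. by move=> ab; rewrite mdegD mdeg_xmon mdeg_tmon. Qed.

Lemma mdeg_tt a b g e : a != b -> g != e -> mdeg (tmon a b + tmon g e) = 2%N.
Proof. by move=> ab ge; rewrite mdegD !mdeg_tmon. Qed.

Lemma mon_mdeg_xt x a b k : a != b -> mon_mdeg (xmon x + tmon a b) k =
  ((pos x == k) + ((d + a == k) + (d + b == k)))%N.
Proof. by move=> ab; rewrite mon_mdegD mon_mdeg_xmon mon_mdeg_tmon. Qed.

Lemma mon_mdeg_tt a b g e k : a != b -> g != e ->
  mon_mdeg (tmon a b + tmon g e) k =
  ((d + a == k) + (d + b == k) + ((d + g == k) + (d + e == k)))%N.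
Proof. by move=> ab ge; rewrite mon_mdegD !mon_mdeg_tmon. Qed.

(** The three products have the same multidegree. The second degree discards
    T_{a,b} T_{g,e}, and T_{a,g} is larger than T_{a,e}. *)
Lemma leads_P a b g e : (a < b < g)%N -> (g < e)%N ->
  leads (P K a b g e) (tmon a g + tmon b e)%MM.
Proof.
move=> /andP[ab bg] ge.
have [ag ae be] : [/\ (a < g)%N, (a < e)%N & (b < e)%N] by split; lia.
exists (-1), (T K a b * T K g e + T K a e * T K b g); split.
- by rewrite oppr_eq0 oner_neq0.
- by rewrite scaleN1r /P !TT // addrA [- _ + _]addrC.
- rewrite !TT //; apply: belowD; apply: belowX;
    rewrite ?mdeg_tt ?neq_lt //.
  + apply: mon_lt_sdeg => [k|].
      by rewrite !mon_mdeg_tt ?neq_lt //; lia.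
    by rewrite !mon_sdegD !mon_sdeg_tmon //; have := ltn_ord g; lia.
  + apply: (mon_lt_lex (v := inr (exist _ (a, g) ag))) => [k||/=|].
    * by rewrite !mon_mdeg_tt ?neq_lt //; lia.
    * by rewrite !mon_sdegD !mon_sdeg_tmon.
    * by rewrite !mnmDE !tmon_inr ?neq_lt //=; lia.
    * move=> [x|u] /=; rewrite !mnmDE ?tmon_inl // /tvar_gt => gt.
      rewrite !tmon_inr ?neq_lt //; move: gt; rewrite -!val_eqE /=; lia.
- by rewrite mdeg_tt ?neq_lt.
Qed.

(** All terms have the same multidegree; the second degree discards T_{b,g}, and
    the second row decreases in the order on the variables. *)
Lemma leads_M a b g : (a < b < g)%N ->
  leads (M K a b g) (xmon (mu2 b) + tmon a g)%MM.
Proof.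
move=> /andP[ab bg]; have ag : (a < g)%N by lia.
exists (-1), (XS K (mu2 a) * T K b g + XS K (mu2 g) * T K a b); split.
- by rewrite oppr_eq0 oner_neq0.
- by rewrite scaleN1r /M !XST // addrA [- _ + _]addrC.
- rewrite !XST //; apply: belowD; apply: belowX;
    rewrite ?mdeg_xt ?neq_lt //.
  + apply: mon_lt_sdeg => [k|].
      by rewrite !mon_mdeg_xt ?neq_lt // !pos_mu2; lia.
    rewrite !mon_sdegD !mon_sdeg_tmon // !mon_sdeg_xmon.
    by have := ltn_ord b; lia.
  + apply: (mon_lt_lex (v := inl (mu2 b))) => [k||/=|].
    * by rewrite !mon_mdeg_xt ?neq_lt // !pos_mu2; lia.
    * by rewrite !mon_sdegD !mon_sdeg_tmon // !mon_sdeg_xmon.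
    * rewrite !mnmDE !tmon_inl !xmon_inl eqxx.
      case: eqVneq => // /mu2_inj E; move: bg; rewrite E ltnn //.
    * move=> [x|//] /=; rewrite xvar_gtE // pos_mu2 => gt.
      rewrite !mnmDE !tmon_inl !xmon_inl.
      by do 2![case: eqVneq => [E|_]; first by move: gt; rewrite -E pos_mu2; lia].
- by rewrite mdeg_xt ?neq_lt.
Qed.

(** The first row is unimodal in [pos], so the smallest of three entries is at
    an end. *)
Lemma pos_mu1_mid a b g : (a < b < g)%N ->
  (pos (mu1 a) < pos (mu1 b))%N || (pos (mu1 g) < pos (mu1 b))%N.
Proof.
move=> /andP[ab bg]; case: (ltnP b (c - d)) => [bc|bc].
  by rewrite pos_mu1_inner.
by rewrite (pos_mu1_outer n_gt0 n_mono bc bg) orbT.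
Qed.

Lemma mon_lt_x x y a b g e : a != b -> g != e ->
    (pos x < pos y)%N -> (pos x < d + a)%N -> (pos x < d + b)%N ->
    (pos x <= d + g)%N -> (pos x <= d + e)%N ->
  mon_lt (xmon y + tmon a b)%MM (xmon x + tmon g e)%MM.
Proof.
move=> ab ge xy xa xb xg xe; apply: (@mon_lt_mdeg _ _ _ _ (pos x)) => [|k Ek|k].
- exact: pos_lt_dc.
- by rewrite !mon_mdeg_xt // -Ek; lia.
- by rewrite !mon_mdeg_xt //; lia.
Qed.

(** A first-row entry precedes the second-row entry of its column, so the
    smallest index in the multidegrees of the terms of L is the smallest
    position of its three first-row entries. *)
Lemma leads_L_first a b g : (a < b < g)%N -> (pos (mu1 a) < pos (mu1 g))%N ->
  leads (L K a b g) (xmon (mu1 a) + tmon b g)%MM.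
Proof.
move=> abg wag; have := pos_mu1_mid abg; have /andP[ab bg] := abg => mid.
have ag := ltn_trans ab bg.
have [pa pb] := (pos_mu1_mu2 n_gt0 a, pos_mu1_mu2 n_gt0 b).
have pg := pos_mu1_mu2 n_gt0 g.
exists 1, (- (XS K (mu1 b) * T K a g) + XS K (mu1 g) * T K a b); split.
- exact: oner_neq0.
- by rewrite scale1r /L !XST // addrA.
- rewrite !XST //; apply: belowD; first apply: belowN;
    (apply: belowX; [apply: mon_lt_x|]); rewrite ?mdeg_xt ?neq_lt //; lia.
- by rewrite mdeg_xt ?neq_lt.
Qed.

Lemma leads_L_last a b g : (a < b < g)%N -> (pos (mu1 g) < pos (mu1 a))%N ->
  leads (L K a b g) (xmon (mu1 g) + tmon a b)%MM.
Proof.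
move=> abg wga; have := pos_mu1_mid abg; have /andP[ab bg] := abg => mid.
have ag := ltn_trans ab bg.
have [pa pb] := (pos_mu1_mu2 n_gt0 a, pos_mu1_mu2 n_gt0 b).
have pg := pos_mu1_mu2 n_gt0 g.
exists 1, (XS K (mu1 a) * T K b g - XS K (mu1 b) * T K a g); split.
- exact: oner_neq0.
- by rewrite scale1r /L !XST // addrC.
- rewrite !XST //; apply: belowD; last apply: belowN;
    (apply: belowX; [apply: mon_lt_x|]); rewrite ?mdeg_xt ?neq_lt //; lia.
- by rewrite mdeg_xt ?neq_lt.
Qed.

Lemma TT_neq a b g e : a != b -> g != e -> exists2 k : K, k != 0 &
  T K a b * T K g e = k *: 'X_[tmon a b + tmon g e].
Proof.
move=> /T_neq[k k0 ->] /T_neq[l l0 ->]; exists (k * l); first by rewrite mulf_neq0.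
by rewrite -scalerAl -scalerAr scalerA mpolyXD.
Qed.

Lemma below_TT a b g e m : a != b -> g != e ->
  mon_lt (tmon a b + tmon g e)%MM m -> below m (T K a b * T K g e).
Proof.
move=> ab ge lt; have [k _ ->] := TT_neq ab ge.
by apply: belowZ; apply: belowX; rewrite ?mdeg_tt.
Qed.

Lemma bar_neq a b : (a < b)%N -> (b < c - d)%N -> bar a != bar b.
Proof.
move=> ab bc; apply: contraTneq (ab) => /(bar_inj n_gt0 (ltn_trans ab bc) bc) ->.
by rewrite ltnn.
Qed.

(** As [bar] increases indices, a and b are the two smallest indices in the
    multidegrees, and only the first product contains both. *)
Lemma leads_Q a b g e : (a < b < g)%N -> (g < e)%N -> (e < c - d)%N ->
  leads (Q K a b g e) (tmon a b + tmon (bar g) (bar e))%MM.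
Proof.
move=> /andP[ab bg] ge ec.
have [ag ae be] : [/\ (a < g)%N, (a < e)%N & (b < e)%N] by split; lia.
have [ac bc gc] : [/\ (a < c - d)%N, (b < c - d)%N & (g < c - d)%N] by split; lia.
have [a1 b1] := (bar_gt n_gt0 ac, bar_gt n_gt0 bc).
have [g1 e1] := (bar_gt n_gt0 gc, bar_gt n_gt0 ec).
have ngh := bar_neq ge ec.
have [k k0 Ek] := TT_neq (neq_lt ab) ngh.
exists k, (- (T K a g * T K (bar b) (bar e)) + T K a e * T K (bar b) (bar g)
  + T K b g * T K (bar a) (bar e) - T K b e * T K (bar a) (bar g)
  + T K g e * T K (bar a) (bar b)); split=> //.
- by rewrite -Ek /Q !addrA.
- apply: belowD; [apply: belowD; [apply: belowD; [apply: belowD; [apply: belowN|]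
    |]|apply: belowN]|]; apply: below_TT; rewrite ?bar_neq ?neq_lt //.
  + apply: (mon_lt_mdeg (lt_dc b)) => k' Ek';
      rewrite !mon_mdeg_tt ?bar_neq ?neq_lt //; lia.
  + apply: (mon_lt_mdeg (lt_dc b)) => k' Ek';
      rewrite !mon_mdeg_tt ?bar_neq ?neq_lt //; lia.
  + apply: (mon_lt_mdeg (lt_dc a)) => k' Ek';
      rewrite !mon_mdeg_tt ?bar_neq ?neq_lt //; lia.
  + apply: (mon_lt_mdeg (lt_dc a)) => k' Ek';
      rewrite !mon_mdeg_tt ?bar_neq ?neq_lt //; lia.
  + apply: (mon_lt_mdeg (lt_dc a)) => k' Ek';
      rewrite !mon_mdeg_tt ?bar_neq ?neq_lt //; lia.
- by rewrite mdeg_tt // neq_lt.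
Qed.

(** An L has its leading term at the end with the smaller first-row entry. *)
Inductive gen_lead : Sring K n -> mon -> Prop :=
| LeadP a b g e : (a < b < g)%N -> (g < e)%N ->
    gen_lead (P K a b g e) (tmon a g + tmon b e)
| LeadQ a b g e : (a < b < g)%N -> (g < e)%N -> (e < c - d)%N ->
    gen_lead (Q K a b g e) (tmon a b + tmon (bar g) (bar e))
| LeadL_first a b g : (a < b < g)%N -> (pos (mu1 a) < pos (mu1 g))%N ->
    gen_lead (L K a b g) (xmon (mu1 a) + tmon b g)
| LeadL_last a b g : (a < b < g)%N -> (pos (mu1 g) < pos (mu1 a))%N ->
    gen_lead (L K a b g) (xmon (mu1 g) + tmon a b)
| LeadM a b g : (a < b < g)%N ->
    gen_lead (M K a b g) (xmon (mu2 b) + tmon a g).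

Lemma gen_lead_gens f m : gen_lead f m -> rees_gens f.
Proof. by case=> *; [apply: GenP|apply: GenQ|apply: GenL|apply: GenL|apply: GenM]. Qed.

Lemma gens_gen_lead (f : Sring K n) : rees_gens f -> exists m, gen_lead f m.
Proof.
case=> [a b g e ? ?|a b g e ? ? ?|a b g abg|a b g abg].
- by eexists; apply: LeadP.
- by eexists; apply: LeadQ.
- have /andP[ab bg] := abg; have ag := ltn_trans ab bg.
  case: (ltngtP (pos (mu1 a)) (pos (mu1 g))) => [lt|lt|].
  + by eexists; apply: LeadL_first.
  + by eexists; apply: LeadL_last.
  + by move/(pos_inj n_gt0)/mu1_inj => E; rewrite E ltnn in ag.
- by eexists; apply: LeadM.
Qed.

Lemma gen_lead_leads f m : gen_lead f m -> leads f m.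
Proof.
by case=> *; [apply: leads_P|apply: leads_Q|apply: leads_L_first
  |apply: leads_L_last|apply: leads_M].
Qed.

Lemma gens_lead (f : Sring K n) : rees_gens f -> exists m, is_lead (@mon_lt d n) f m.
Proof. by move=> /gens_gen_lead[m /gen_lead_leads/leads_is_lead]; exists m. Qed.

Lemma gens_homog (f : Sring K n) m : rees_gens f -> m \in msupp f -> mdeg m = 2%N.
Proof. by move=> /gens_gen_lead[m' /gen_lead_leads]; apply: leads_homog. Qed.

Lemma gens_lead_gen_lead (f : Sring K n) m :
  rees_gens f -> is_lead (@mon_lt d n) f m -> gen_lead f m.
Proof.
move=> /gens_gen_lead[m' Hm']; have := leads_is_lead (gen_lead_leads Hm').
move=> /[swap] lead_m /(is_lead_uniq (@mon_lt_irr d n) (mon_lt_trans n_gt0) lead_m).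
by move=> ->.
Qed.

(** Any variable of smaller position than both first-row entries of T_{a,b} is
    a first-row entry itself. *)
Lemma gen_lead_L x a b : (a < b)%N ->
    (pos x < pos (mu1 a))%N -> (pos x < pos (mu1 b))%N ->
  exists f, gen_lead f (xmon x + tmon a b)%MM.
Proof.
move=> ab xa xb.
have [e Ex] : exists e, x = mu1 e.
  by apply: pos_lt_mu1 => //; apply: ltn_trans xa (pos_mu1_lt n_gt0 a).
subst x; case: (ltngtP e a) => [ea|ae|/val_inj E]; last by rewrite E ltnn in xa.
  by exists (L K e a b); apply: LeadL_first; rewrite ?ea.
case: (ltngtP e b) => [eb|be|/val_inj E]; last by rewrite E ltnn in xb.
  have := @pos_mu1_mid a e b; rewrite ae eb => /(_ isT); lia.
by exists (L K a b e); apply: LeadL_last; rewrite ?ab.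
Qed.

Lemma gen_lead_squarefree f m : gen_lead f m -> squarefree m.
Proof.
have sq (i : 'I_#|var n|) : exists v, i = enum_rank v.
  by exists (enum_val i); rewrite enum_valK.
have xt x a b : a != b -> squarefree (xmon x + tmon a b)%MM.
  move=> ab i; have [[y|u] ->] := sq i; rewrite mnmDE.
    by rewrite tmon_inl xmon_inl; case: eqVneq.
  by rewrite xmon_inr tmon_inr //; case: (_ && _).
have tt a b g e : a != b -> g != e -> minn a b != minn g e ->
    squarefree (tmon a b + tmon g e)%MM.
  move=> ab ge ne i; have [[y|u] ->] := sq i; rewrite mnmDE.
    by rewrite !tmon_inl.
  by rewrite !tmon_inr //; move: ne; lia.
case=> [a b g e|a b g e|a b g|a b g|a b g] /andP[ab bg].
- by move=> ge; apply: tt; rewrite ?neq_lt //; lia.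
- move=> ge ec; have gc := ltn_trans ge ec.
  have [g1 e1] := (bar_gt n_gt0 gc, bar_gt n_gt0 ec).
  by apply: tt; rewrite ?bar_neq ?neq_lt //; lia.
- by move=> _; apply: xt; rewrite neq_lt.
- by move=> _; apply: xt; rewrite neq_lt.
- by apply: xt; rewrite neq_lt // (ltn_trans ab).
Qed.

Lemma mnm1D_eq N (i j k l : 'I_N) : (U_(i) + U_(j) = U_(k) + U_(l))%MM ->
  i = k /\ j = l \/ i = l /\ j = k.
Proof.
move=> E; have := congr1 (fun m : 'X_{1..N} => m i) E.
rewrite !mnmDE !mnm1E eqxx; case: (eqVneq k i) => [Ek _|_].
  by left; split=> //; apply/eqP; rewrite -eq_mnm1 -(eqm_add2l U_(i)) E Ek.
case: (eqVneq l i) => // El _; right; split=> //; apply/eqP.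
by rewrite -eq_mnm1 -(eqm_add2l U_(i)) E El addmC.
Qed.

Lemma tt_inj a b g e a' b' g' e' :
    (a < b)%N -> (g < e)%N -> (a' < b')%N -> (g' < e')%N ->
    (tmon a b + tmon g e = tmon a' b' + tmon g' e')%MM ->
  [/\ a = a', b = b', g = g' & e = e'] \/ [/\ a = g', b = e', g = a' & e = b'].
Proof.
move=> ab ge ab' ge'; rewrite !tmonE => /mnm1D_eq[] [].
  by move=> /enum_rank_inj[-> ->] /enum_rank_inj[-> ->]; left.
by move=> /enum_rank_inj[-> ->] /enum_rank_inj[-> ->]; right.
Qed.

Lemma xt_tt x a b g e s t : (xmon x + tmon a b)%MM <> (tmon g e + tmon s t)%MM.
Proof.
move/(congr1 (fun m : mon => m (enum_rank (inl x : var n)))).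
by rewrite !mnmDE !tmon_inl xmon_inl eqxx.
Qed.

Lemma xt_inj x a b y s t : (a < b)%N -> (s < t)%N ->
  (xmon x + tmon a b)%MM = (xmon y + tmon s t)%MM -> [/\ x = y, a = s & b = t].
Proof.
move=> ab st E; have := congr1 (fun m : mon => m (enum_rank (inl x : var n))) E.
rewrite !mnmDE !tmon_inl !xmon_inl eqxx; case: eqVneq => // Exy _; subst y.
move/eqP: E; rewrite eqm_add2l => /eqP; rewrite !tmonE => /eqP.
by rewrite eq_mnm1 => /eqP/enum_rank_inj[-> ->].
Qed.

(** The two pairs of columns cross in the leading monomial of a P and are
    separated in that of a Q; the variable x of the leading monomial of an L
    precedes its pair of columns, whereas that of an M lies inside. *)
Lemma gen_lead_inj f h m : gen_lead f m -> gen_lead h m -> f = h.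
Proof.
suff H f' h' m1 m2 : gen_lead f' m1 -> gen_lead h' m2 -> m1 = m2 -> f' = h'.
  by move=> Hf /(H _ _ _ _ Hf); apply.
have sorted_bars g e : (g < e)%N -> (e < c - d)%N -> exists s t,
    [/\ (s < t)%N, (g < s)%N, tmon (bar g) (bar e) = tmon s t
      & s = bar g /\ t = bar e \/ s = bar e /\ t = bar g].
  move=> ge ec; have g1 := bar_gt n_gt0 (ltn_trans ge ec).
  have e1 := ltn_trans ge (bar_gt n_gt0 ec).
  have := bar_neq ge ec; rewrite neq_ltn => /orP[lt|lt].
    by exists (bar g), (bar e); split=> //; left.
  by exists (bar e), (bar g); split=> //; [rewrite tmonC|right].
have PQ a b g e a' b' g' e' : (a < b < g)%N -> (g < e)%N ->
    (a' < b' < g')%N -> (g' < e')%N -> (e' < c - d)%N ->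
    (tmon a g + tmon b e)%MM <> (tmon a' b' + tmon (bar g') (bar e'))%MM.
  move=> /andP[ab bg] ge /andP[ab' bg'] ge' ec'.
  have [s [t [st gs -> _]]] := sorted_bars _ _ ge' ec'.
  move/(tt_inj (ltn_trans ab bg) (ltn_trans bg ge) ab' st).
  by case=> -[Ea Eb Eg Ee]; move: ab bg; rewrite Ea Eb Eg; lia.
case=> [a b g e abg ge|a b g e abg ge ec|a b g abg lt|a b g abg lt|a b g abg];
case=> [a' b' g' e' abg' ge'|a' b' g' e' abg' ge' ec'|a' b' g' abg' lt'
  |a' b' g' abg' lt'|a' b' g' abg'] E;
  try by [case: (xt_tt E) | case: (xt_tt (esym E))
   | case: (PQ _ _ _ _ _ _ _ _ abg ge abg' ge' ec' E)
   | case: (PQ _ _ _ _ _ _ _ _ abg' ge' abg ge ec (esym E))].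
- case/andP: abg abg' => ab bg /andP[ab' bg'].
  have := tt_inj (ltn_trans ab bg) (ltn_trans bg ge) (ltn_trans ab' bg')
    (ltn_trans bg' ge') E.
  by case=> -[Ea Eb Eg Ee]; [rewrite Ea Eb Eg Ee|move: ab ab'; rewrite Ea Eg; lia].
- case/andP: abg abg' => ab bg /andP[ab' bg'].
  have [s [t [st gs Est Hst]]] := sorted_bars _ _ ge ec.
  have [s' [t' [st' gs' Est' Hst']]] := sorted_bars _ _ ge' ec'.
  have [gc gc'] := (ltn_trans ge ec, ltn_trans ge' ec').
  have binj := bar_inj n_gt0.
  rewrite Est Est' in E; case: (tt_inj ab st ab' st' E) => -[Ea Eb Es Et]; last first.
    by move: gs gs' ab ab' bg bg'; rewrite Ea Es; lia.
  subst a' b' s' t'; case: Hst Hst' => -[Es Et] [] [Es' Et'].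
  + have Eg : g = g' by apply: binj gc gc' _; rewrite -Es Es'.
    by have Ee : e = e' by [apply: binj ec ec' _; rewrite -Et Et']; rewrite Eg Ee.
  + have Eg : g = e' by apply: binj gc ec' _; rewrite -Es Es'.
    have Ee : e = g' by apply: binj ec gc' _; rewrite -Et Et'.
    by move: ge; rewrite Eg Ee ltnNge ltnW.
  + have Eg : g = e' by apply: binj gc ec' _; rewrite -Et Et'.
    have Ee : e = g' by apply: binj ec gc' _; rewrite -Es Es'.
    by move: ge; rewrite Eg Ee ltnNge ltnW.
  + have Eg : g = g' by apply: binj gc gc' _; rewrite -Et Et'.
    by have Ee : e = e' by [apply: binj ec ec' _; rewrite -Es Es']; rewrite Eg Ee.
- have /andP[ab bg] := abg; have /andP[ab' bg'] := abg'.
  by have [/mu1_inj -> -> ->] := xt_inj bg bg' E.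
- have /andP[ab bg] := abg; have /andP[ab' bg'] := abg'.
  have [/mu1_inj Ea Eb Eg] := xt_inj bg ab' E.
  by move: ab bg'; rewrite Ea Eb; lia.
- have /andP[ab bg] := abg; have /andP[ab' bg'] := abg'.
  have [Ex Eb Eg] := xt_inj bg (ltn_trans ab' bg') E.
  have := pos_mu1_mu2 n_gt0 a; rewrite Ex pos_mu2; move: ab ab'; rewrite Eb; lia.
- have /andP[ab bg] := abg; have /andP[ab' bg'] := abg'.
  have [/mu1_inj Ea Eb Eg] := xt_inj ab bg' E.
  by move: bg ab'; rewrite Ea Eg; lia.
- have /andP[ab bg] := abg; have /andP[ab' bg'] := abg'.
  by have [/mu1_inj -> -> ->] := xt_inj ab ab' E.
- have /andP[ab bg] := abg; have /andP[ab' bg'] := abg'.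
  have [Ex Eb Eg] := xt_inj ab (ltn_trans ab' bg') E.
  by have := pos_mu1_mu2 n_gt0 a; move: lt; rewrite Ex pos_mu2 Eb; lia.
- have /andP[ab bg] := abg; have /andP[ab' bg'] := abg'.
  have [Ex Eb Eg] := xt_inj (ltn_trans ab bg) bg' E.
  have := pos_mu1_mu2 n_gt0 a'; rewrite -Ex pos_mu2; move: ab ab'; rewrite -Eb; lia.
- have /andP[ab bg] := abg; have /andP[ab' bg'] := abg'.
  have [Ex Eb Eg] := xt_inj (ltn_trans ab bg) ab' E.
  by have := pos_mu1_mu2 n_gt0 a'; move: lt'; rewrite -Ex pos_mu2 -Eb; lia.
- have /andP[ab bg] := abg; have /andP[ab' bg'] := abg'.
  by have [/mu2_inj -> -> ->] := xt_inj (ltn_trans ab bg) (ltn_trans ab' bg') E.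
Qed.

End Leads.

(** * Images of monomials in R[t] *)

Section Images.
Context (K : fieldType) (d : nat) (n : 'I_d -> nat).
Local Notation c := (ncols n).
Local Notation mon := 'X_{1..#|var n|}.
Local Notation rmon := 'X_{1..#|xvar n|}.
Local Notation R := {mpoly K[#|xvar n|]}.
Implicit Types (a b g e s t : 'I_c) (x y : xvar n) (u : tvar n) (v : var n).
Implicit Types (m : mon).

Lemma big_var (V : Type) (idx : V) (op : Monoid.com_law idx)
    (F : 'I_#|var n| -> V) :
  \big[op/idx]_i F i = op (\big[op/idx]_(x : xvar n) F (enum_rank (inl x : var n)))
                          (\big[op/idx]_(u : tvar n) F (enum_rank (inr u : var n))).
Proof.
rewrite (reindex (@enum_rank (var n))) /=; last exact/onW_bij/enum_rank_bij.
by rewrite big_sumType.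
Qed.

Definition Pi_coef v : R :=
  match v with inl x => XR K x | inr u => minor K (val u).1 (val u).2 end.

Definition Pi_mon m : R := \prod_i Pi_coef (enum_val i) ^+ m i.

Definition tdeg m : nat := (\sum_(u : tvar n) m (enum_rank (inr u : var n)))%N.

Lemma PiE (f : Sring K n) k :
  (Pi f)`_k = \sum_(m <- msupp f | tdeg m == k) f@_m *: Pi_mon m.
Proof.
have PiX m : mmap1 (fun i => Pi_var K (enum_val i)) m = Pi_mon m *: 'X^(tdeg m).
  rewrite /mmap1 /Pi_mon !big_var /= -mul_polyC rmorphM /= !rmorph_prod /=.
  rewrite -!mulrA; congr (_ * _).
    by apply: eq_bigr => x _; rewrite !enum_rankK rmorphXn.
  rewrite /tdeg -prodrXr -big_split /=.
  apply: eq_bigr => u _; rewrite !enum_rankK /= -mul_polyC exprMn_comm.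
    by rewrite rmorphXn.
  exact: commr_polyX.
rewrite /Pi /mmap coef_sum [RHS]big_mkcond; apply: eq_bigr => m _.
rewrite PiX /= coefCM coefZ coefXn eq_sym; case: eqP => _.
  by rewrite mulr1 mul_mpolyC.
by rewrite !mulr0.
Qed.
End Images.

(** * Weights *)

Section Weights.
Context (K : fieldType) (d : nat) (n : 'I_d -> nat).
Context (n_gt0 : forall i : 'I_d, (1 <= n i)%N).
Context (n_mono : forall i j : 'I_d, (i <= j)%N -> (n i <= n j)%N).
Local Notation c := (ncols n).
Local Notation mon := 'X_{1..#|var n|}.
Local Notation rmon := 'X_{1..#|xvar n|}.
Local Notation R := {mpoly K[#|xvar n|]}.
Implicit Types (a b g e s t : 'I_c) (x y : xvar n) (v : var n).
Implicit Types (m : mon) (u : rmon).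

Definition weight (f : xvar n -> nat) u : nat :=
  (\sum_i u i * f (enum_val i))%N.

Lemma weightD f u u' : weight f (u + u') = (weight f u + weight f u')%N.
Proof.
by rewrite /weight -big_split; apply: eq_bigr => i _; rewrite mnmDE mulnDl.
Qed.

Lemma weight0 f : weight f 0%MM = 0%N.
Proof. by rewrite /weight big1 // => i _; rewrite mnm0E. Qed.

Lemma weightU f x : weight f U_(enum_rank x) = f x.
Proof.
rewrite /weight (bigD1 (enum_rank x)) //= big1 ?addn0 => [|i ne].
  by rewrite mnm1E eqxx mul1n enum_rankK.
by rewrite mnm1E eq_sym (negPf ne) mul0n.
Qed.

Lemma weightMn f u k : weight f (u *+ k) = (k * weight f u)%N.
Proof.
rewrite /weight big_distrr /=; apply: eq_bigr => i _.
by rewrite mulmnE (mulnC (u i)) mulnA.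
Qed.

Context (B : nat) (B_lt : (B < c)%N).

(** [lam] is lowered before position [B] so that, by [nu_diag], both terms of
    a minor weigh at most [lam] of its second-row entries plus a constant. *)
Definition nu x : nat := (lam x - (B - pos x))%N.

(** For a [good] T the two terms of the minor can have the same [nu] only if
    both first-row entries have position at most [B]. Then [rho] prefers the later second-row
    entry, except that the last d rank above the others and in reverse order,
    as [pos] is decreasing on the first row of the last d columns. *)
Definition rho x : nat :=
  if (pos x <= B)%N then 0%N
  else if (pos x < c)%N then (pos x - B)%N
  else (c - B + (c + d - pos x))%N.

Definition ltw : rel rmon := fun u u' =>
  (weight nu u < weight nu u')%N ||
  (weight nu u == weight nu u') && (weight rho u < weight rho u')%N.

Lemma ltw_irr : irreflexive ltw.
Proof. by move=> u; rewrite /ltw !ltnn andbF. Qed.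

Lemma ltw_trans : transitive ltw.
Proof. by move=> u u' u''; rewrite /ltw; lia. Qed.

Lemma ltw_add u u' u'' : ltw u' u'' -> ltw (u + u')%MM (u + u'')%MM.
Proof. by rewrite /ltw !weightD !ltn_add2l eqn_add2l. Qed.

(** * Leading terms of the minors *)

Definition diag a b : rmon := (U_(enum_rank (mu1 a)) + U_(enum_rank (mu2 b)))%MM.

Lemma minorE a b : minor K a b = 'X_[diag a b] - 'X_[diag b a] :> R.
Proof. by rewrite /minor /diag !mpolyXD. Qed.

Lemma lam_ge x : (c - pos x <= lam x)%N.
Proof.
case: (ltnP (pos x) c) => [/(pos_lt_mu1 n_gt0)[a ->]|]; last by lia.
by rewrite lam_mu1 leq_addl.
Qed.

(** The left summands other than the weight are truncated differences: they
    measure how far the first-row entry lies beyond [B] and the second-row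
    entry before it. *)
Lemma nu_diag a b :
  (weight nu (diag a b) + ((pos (mu1 a) - B) + (B - (d + b))) =
   lam (mu2 a) + lam (mu2 b) + (c - B))%N.
Proof.
rewrite weightD !weightU /nu lam_mu1 pos_mu2.
have := lam_ge (mu2 b); have := pos_mu1_lt n_gt0 a; rewrite pos_mu2; lia.
Qed.

(** The tops that a leading term may take from the left end of a T. *)
Definition small a : bool := (a < c - d)%N && (pos (mu1 a) <= B)%N.

Definition top_col a b : 'I_c := if small a then a else b.
Definition bot_col a b : 'I_c := if small a then b else a.

(** The bound on [nu] for the image of [v]; by [Lam_gt] and [lead_good] it is
    attained if and only if [v] is [good]. *)
Definition Lam v : nat :=
  match v with
  | inl x => lam x
  | inr u => (lam (mu2 (val u).1) + lam (mu2 (val u).2) + (c - B))%N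
  end.

Definition good v : bool :=
  match v with
  | inl x => (B <= pos x)%N
  | inr u => (B <= d + (val u).2)%N &&
      ((pos (mu1 (val u).1) <= B)%N || (pos (mu1 (val u).2) <= B)%N)
  end.

Definition lead_var v : rmon :=
  match v with
  | inl x => U_(enum_rank x)%MM
  | inr u => diag (top_col (val u).1 (val u).2) (bot_col (val u).1 (val u).2)
  end.

Lemma Lam_ge v :
  supp_in (fun u => (weight nu u <= Lam v)%N) (Pi_coef K v).
Proof.
case: v => [x|[[a b] /= ab]].
  by apply: supp_inX; rewrite weightU /nu leq_subr.
rewrite minorE; apply: supp_inD; last apply: supp_inN; apply: supp_inX.
  by have := nu_diag a b; lia.
by have := nu_diag b a; lia.
Qed.

Lemma Lam_gt v : ~~ good v ->
  supp_in (fun u => (weight nu u < Lam v)%N) (Pi_coef K v).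
Proof.
case: v => [x|[[a b] /= ab]] /=.
  rewrite -ltnNge => xB; apply: supp_inX; rewrite weightU /nu.
  by have := lam_ge x; lia.
rewrite minorE => bad; apply: supp_inD; last apply: supp_inN; apply: supp_inX.
  by have := nu_diag a b; lia.
by have := nu_diag b a; lia.
Qed.

(** If column [a] is not small then column [b] is one of the last [d], and
    among those the later ones have smaller first-row entries. *)
Lemma good_outer a b : (a < b)%N -> ~~ small a ->
    (pos (mu1 a) <= B)%N || (pos (mu1 b) <= B)%N ->
  (c - d <= b)%N && (pos (mu1 b) <= B)%N.
Proof.
move=> ab; rewrite /small negb_and -leqNgt -ltnNge => nsmall touch.
case: (ltnP b (c - d)) => [bc|bc] /=.
  by have := pos_mu1_inner n_gt0 ab bc; lia.
case: (ltnP a (c - d)) => [ac|ac]; first by lia.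
by have := pos_mu1_outer n_gt0 n_mono ac ab; lia.
Qed.

Lemma lead_good v : good v ->
  lead_form ltw (Pi_coef K v) (lead_var v) /\ weight nu (lead_var v) = Lam v.
Proof.
case: v => [x|[[a b] /= ab]] /=.
  move=> xB; rewrite weightU /nu; split; last by lia.
  exists 1, 0; rewrite oner_neq0 scale1r addr0; split=> // u.
  by rewrite msupp0.
case/andP=> bB touch; rewrite /top_col /bot_col minorE.
have Eab := nu_diag a b; have Eba := nu_diag b a.
have rho_diag e g : weight rho (diag e g) = (rho (mu1 e) + rho (mu2 g))%N.
  by rewrite weightD !weightU.
have pa := pos_mu1_lt n_gt0 a; have pb := pos_mu1_lt n_gt0 b.
have dc := d_le_c n_gt0.
case: ifP => [|/negbT] sm.
  have Ew : weight nu (diag a b) = (lam (mu2 a) + lam (mu2 b) + (c - B))%N.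
    by move: sm; rewrite /small; lia.
  split=> //; exists 1, (- 'X_[diag b a]); split.
  - exact: oner_neq0.
  - by rewrite scale1r.
  - apply: supp_inN; apply: supp_inX; rewrite /ltw Ew.
    have [lt|ge] := ltnP (weight nu (diag b a)) (lam (mu2 a) + lam (mu2 b) + (c - B)).
      by [].
    rewrite !rho_diag /rho !pos_mu2; move: sm; rewrite /small.
    by do 6?case: ifP; lia.
have /andP[bc pbB] := good_outer ab sm touch.
have ac : (pos (mu1 a) <= B)%N -> (c - d <= a)%N.
  by move: sm; rewrite /small; lia.
have aB : (B <= d + a)%N.
  have [/ac|] := leqP (pos (mu1 a)) B; first by lia.
  by have := pos_mu1_mu2 n_gt0 a; lia.
have Ew : weight nu (diag b a) = (lam (mu2 a) + lam (mu2 b) + (c - B))%N by lia.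
split=> //; exists (-1), 'X_[diag a b]; split.
- by rewrite oppr_eq0 oner_neq0.
- by rewrite scaleN1r addrC.
- apply: supp_inX; rewrite /ltw Ew.
  have [lt|ge] := ltnP (weight nu (diag a b)) (lam (mu2 a) + lam (mu2 b) + (c - B)).
    by [].
  have paB : (pos (mu1 a) <= B)%N by lia.
  have := ltn_ord b; have := ac paB.
  by rewrite !rho_diag /rho !pos_mu2 pbB paB; do 4?case: ifP; lia.
Qed.

(** * Leading terms of the images of monomials *)

Definition mon_lam m : nat := (\sum_i m i * Lam (enum_val i))%N.

Definition lead_mon m : rmon := (\sum_i lead_var (enum_val i) *+ m i)%MM.

Definition good_mon m : bool := [forall i, (0 < m i)%N ==> good (enum_val i)].

Let ub L (p : R) := supp_in (fun u => (weight nu u <= L)%N) p.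

Lemma ubM L L' p p' : ub L p -> ub L' p' -> ub (L + L') (p * p').
Proof. by apply: supp_inM => u u'; rewrite weightD; lia. Qed.

Lemma ub1 : ub 0 1.
Proof. by rewrite -mpolyX0; apply: supp_inX; rewrite weight0. Qed.

Lemma ubX L p k : ub L p -> ub (k * L) (p ^+ k).
Proof.
move=> Lp; elim: k => [|k IH]; first exact: ub1.
by rewrite exprS mulSn; apply: ubM.
Qed.

Lemma Pi_mon_le m : supp_in (fun u => (weight nu u <= mon_lam m)%N) (Pi_mon K m).
Proof.
rewrite /Pi_mon /mon_lam; apply: (big_ind2 (fun p L => ub L p)).
- exact: ub1.
- by move=> *; apply: ubM.
- by move=> i _; apply/ubX/Lam_ge.
Qed.

Lemma Pi_mon_lt m : ~~ good_mon m ->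
  supp_in (fun u => (weight nu u < mon_lam m)%N) (Pi_mon K m).
Proof.
rewrite negb_forall => /existsP[i]; rewrite negb_imply => /andP[mi bad].
rewrite /Pi_mon (bigD1 i) //= /mon_lam (bigD1 i) //=.
rewrite -(prednK mi) exprS mulSn -mulrA -addnA.
apply: (@supp_inM _ _ (fun u => weight nu u < Lam (enum_val i))%N
  (fun u => (weight nu u <=
    (m i).-1 * Lam (enum_val i) + \sum_(j | j != i) m j * Lam (enum_val j))%N)).
- by move=> u u' lt_u le_u'; rewrite weightD -addSn; apply: leq_add.
- exact: Lam_gt.
- apply: ubM; first exact/ubX/Lam_ge.
  apply: (big_ind2 (fun p L => ub L p)).
  + exact: ub1.
  + by move=> *; apply: ubM.
  + by move=> j _; apply/ubX/Lam_ge.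
Qed.

Lemma Pi_mon_lead m : good_mon m ->
  lead_form ltw (Pi_mon K m) (lead_mon m) /\ weight nu (lead_mon m) = mon_lam m.
Proof.
move=> /forallP gm; split.
  apply: (big_ind2 (lead_form ltw)).
  - exact: lead_form1.
  - by move=> *; apply: lead_formM ltw_trans ltw_add _ _.
  - move=> i _; case: (posnP (m i)) => [->|mi]; first exact: lead_form1.
    have [lead_i _] := lead_good (implyP (gm i) mi).
    elim: (m i) => [|k IH]; first exact: lead_form1.
    by rewrite exprS mulmS; apply: lead_formM ltw_trans ltw_add _ _.
rewrite /lead_mon /mon_lam; apply: (big_ind2 (fun u L => weight nu u = L)).
- exact: weight0.
- by move=> u L u' L' <- <-; rewrite weightD.
- move=> i _; rewrite weightMn; case: (posnP (m i)) => [->//|mi].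
  by have [_ ->] := lead_good (implyP (gm i) mi).
Qed.

End Weights.

(** * Recovering a monomial from its leading term *)

Section Recover.
Context (d : nat) (n : 'I_d -> nat).
Context (n_gt0 : forall i : 'I_d, (1 <= n i)%N).
Context (n_mono : forall i j : 'I_d, (i <= j)%N -> (n i <= n j)%N).
Local Notation c := (ncols n).
Local Notation mon := 'X_{1..#|var n|}.
Implicit Types (a b g e s t : 'I_c) (x y : xvar n) (u : tvar n) (v : var n).
Implicit Types (m : mon).

Definition has_x m x : bool := (0 < m (enum_rank (inl x : var n)))%N.

(** A variable T_{a,b} is pictured as an arc from column a to column b. *)
Definition arc m a b : bool := (a < b)%N && (tmon a b <= m)%MM.

Lemma arcE m a b (ab : (a < b)%N) :
  arc m a b = (0 < m (enum_rank (inr (exist _ (a, b) ab) : var n)))%N.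
Proof. by rewrite /arc ab (tmonE ab) lep1mP lt0n. Qed.

Lemma arc_lt m a b : arc m a b -> (a < b)%N.
Proof. by case/andP. Qed.

Lemma arc_le m m' a b : (m <= m')%MM -> arc m a b -> arc m' a b.
Proof. by move=> le /andP[ab /lepm_trans le']; rewrite /arc ab le'. Qed.

Lemma has_x_le m m' x : (m <= m')%MM -> has_x m x -> has_x m' x.
Proof. by move=> /mnm_lepP le xm; apply: leq_trans xm (le _). Qed.

(** What the generators P and M impose on a standard monomial. *)
Definition planar m : Prop :=
  (forall a b g e, arc m a g -> arc m b e -> ~~ [&& a < b, b < g & g < e]%N) /\
  (forall a b g, arc m a g -> has_x m (mu2 b) -> ~~ (a < b < g)%N).

Lemma planar_le m m' : (m <= m')%MM -> planar m' -> planar m.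
Proof.
move=> le [H1 H2]; split=> [a b g e /(arc_le le) ag /(arc_le le) be|a b g].
  exact: H1.
by move=> /(arc_le le) ag /(has_x_le le); apply: H2.
Qed.

Context (B : nat).

Lemma small_lt a b : small B a -> ~~ small B b -> (a < b)%N.
Proof.
rewrite /small  => sa sb; rewrite ltnNge leq_eqVlt.
apply/negP => /orP[/eqP/val_inj E|ba]; first by rewrite E sa in sb.
by have := pos_mu1_inner n_gt0 ba; move: sa sb; lia.
Qed.

Lemma outer_not_small a : (c - d <= a)%N -> ~~ small B a.
Proof. by rewrite /small; lia. Qed.

Context (B_lt : (B < c)%N).

Lemma good_mon_le m m' : (m <= m')%MM -> good_mon B m' -> good_mon B m.
Proof.
move=> /mnm_lepP le /forallP H; apply/forallP => i; apply/implyP => mi.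
by apply: (implyP (H i)); apply: leq_trans mi (le i).
Qed.

Lemma good_has_x m x : good_mon B m -> has_x m x -> (B <= pos x)%N.
Proof.
by move=> /forallP/(_ (enum_rank (inl x : var n))); rewrite enum_rankK => /implyP.
Qed.

Lemma good_arc m a b : good_mon B m -> arc m a b ->
  (B <= d + b)%N && ((pos (mu1 a) <= B)%N || (pos (mu1 b) <= B)%N).
Proof.
move=> /forallP gm ab; have lt := arc_lt ab; move: ab; rewrite (arcE m lt).
move: (gm (enum_rank (inr (exist _ (a, b) lt) : var n))).
by rewrite enum_rankK => /implyP.
Qed.

Lemma arc_top m a b : good_mon B m -> arc m a b -> (pos (mu1 (top_col B a b)) <= B)%N.
Proof.
move=> gm ab; have /andP[bB touch] := good_arc gm ab.
rewrite /top_col; case: ifP => [/andP[] //|/negbT ns].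
by case/andP: (good_outer n_gt0 n_mono B_lt (arc_lt ab) ns touch).
Qed.

Lemma arc_bot m a b : good_mon B m -> arc m a b -> (B <= d + bot_col B a b)%N.
Proof.
move=> gm ab; have /andP[bB touch] := good_arc gm ab.
rewrite /bot_col; case: ifP => [//|/negbT].
rewrite /small  negb_and -leqNgt -ltnNge.
by have := pos_mu1_mu2 n_gt0 a; have := d_le_c n_gt0; lia.
Qed.

Lemma arc_outer m a b : good_mon B m -> arc m a b -> ~~ small B a -> (c - d <= b)%N.
Proof.
move=> gm ab ns; have /andP[bB touch] := good_arc gm ab.
by case/andP: (good_outer n_gt0 n_mono B_lt (arc_lt ab) ns touch).
Qed.

(** The leading term of an arc is a top, in the first row, times a bottom, in
    the second row; the x's of [m] are counted with the bottoms. *)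
Definition tops m x : nat :=
  (\sum_u m (enum_rank (inr u : var n)) *
     (mu1 (top_col B (val u).1 (val u).2) == x))%N.

Definition bots m x : nat :=
  (m (enum_rank (inl x : var n)) +
   \sum_u m (enum_rank (inr u : var n)) *
     (mu2 (bot_col B (val u).1 (val u).2) == x))%N.

Lemma lead_monE m x : lead_mon B m (enum_rank x) = (tops m x + bots m x)%N.
Proof.
rewrite /lead_mon mnm_sumE big_var /= /tops /bots addnCA; congr (_ + _)%N.
  rewrite (bigD1 x) //= big1 ?addn0 => [|y yx].
    by rewrite enum_rankK mulmnE /= mnm1E eqxx mul1n.
  by rewrite enum_rankK mulmnE /= mnm1E (inj_eq enum_rank_inj) (negPf yx).
rewrite -big_split; apply: eq_bigr => u _; rewrite enum_rankK mulmnE /= mnmDE.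
by rewrite !mnm1E !(inj_eq enum_rank_inj) mulnDl ![(_ * m _)%N]mulnC.
Qed.

Lemma tops_gt0 m x : (0 < tops m x)%N ->
  exists a b, arc m a b /\ mu1 (top_col B a b) = x.
Proof.
rewrite lt0n sum_nat_eq0 negb_forall => /existsP[[[a b] ab]] /=.
rewrite muln_eq0 negb_or eqb0 negbK -lt0n -arcE => /andP[arc_ab /eqP Ex].
by exists a, b.
Qed.

Lemma arc_tops m a b : arc m a b -> (0 < tops m (mu1 (top_col B a b)))%N.
Proof.
move=> arc_ab; have ab := arc_lt arc_ab.
rewrite /tops (bigD1 (exist _ (a, b) ab : tvar n)) //= eqxx muln1 ltn_addr //.
by rewrite -arcE.
Qed.

Lemma bots_gt0 m s : (0 < bots m (mu2 s))%N ->
  has_x m (mu2 s) \/ exists a b, arc m a b /\ bot_col B a b = s.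
Proof.
rewrite addn_gt0 => /orP[|]; first by left.
rewrite lt0n sum_nat_eq0 negb_forall => /existsP[[[a b] ab]] /=.
rewrite muln_eq0 negb_or eqb0 negbK -lt0n -arcE => /andP[arc_ab /eqP Ex].
by right; exists a, b; split=> //; apply: mu2_inj.
Qed.

Lemma arc_bots m a b : arc m a b -> (0 < bots m (mu2 (bot_col B a b)))%N.
Proof.
move=> arc_ab; have ab := arc_lt arc_ab; rewrite ltn_addl //.
rewrite (bigD1 (exist _ (a, b) ab : tvar n)) //= eqxx muln1 ltn_addr //.
by rewrite -arcE.
Qed.

Lemma tops_le m x : good_mon B m -> (B < pos x)%N -> tops m x = 0%N.
Proof.
move=> gm xB; apply/eqP; rewrite -leqn0 leqNgt; apply/negP => /tops_gt0.
by move=> [a [b [ab Ex]]]; have := arc_top gm ab; rewrite Ex leqNgt xB.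
Qed.

Lemma bots_ge m x : good_mon B m -> (pos x < B)%N -> bots m x = 0%N.
Proof.
move=> gm xB; apply/eqP; rewrite -leqn0 leqNgt addn_gt0; apply/negP.
case/orP=> [/(good_has_x gm)|]; first by rewrite leqNgt xB.
rewrite lt0n sum_nat_eq0 negb_forall => /existsP[[[a b] ab]] /=.
rewrite muln_eq0 negb_or eqb0 negbK -lt0n -arcE => /andP[arc_ab /eqP Ex].
by have := arc_bot gm arc_ab; rewrite -pos_mu2 Ex leqNgt xB.
Qed.

Lemma sum_tops m : (\sum_x tops m x)%N = tdeg m.
Proof.
rewrite exchange_big /=; apply: eq_bigr => u _; rewrite -big_distrr /=.
rewrite (bigD1 (mu1 (top_col B (val u).1 (val u).2))) //= eqxx big1 ?muln1 // => x.
by rewrite eq_sym => /negPf ->.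
Qed.

(** Tops have position at most [B] and the other variables at least [B]; how
    often the variable at [B] is a top follows from the number of arcs. *)
Lemma lead_mon_split m m' : good_mon B m -> good_mon B m' ->
    tdeg m = tdeg m' -> lead_mon B m = lead_mon B m' ->
  tops m =1 tops m' /\ bots m =1 bots m'.
Proof.
move=> gm gm' Et El.
have E x : (tops m x + bots m x = tops m' x + bots m' x)%N.
  by rewrite -!lead_monE El.
have Etops x : pos x != B -> tops m x = tops m' x.
  rewrite neq_ltn => /orP[lt|gt]; last by rewrite !tops_le.
  by have := E x; rewrite !bots_ge // !addn0.
suff Et' x : tops m x = tops m' x.
  by split=> // x; apply/eqP; rewrite -(eqn_add2l (tops m x)) E Et'.
have [xB|/Etops //] := eqVneq (pos x) B.
have := Et; rewrite -!sum_tops (bigD1 x) //= [in RHS](bigD1 x) //=.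
rewrite (eq_bigr (tops m')) => [/addIn //|y yx]; apply: Etops.
by rewrite -xB; apply: contra yx => /eqP/(pos_inj n_gt0) ->.
Qed.

(** * A common arc *)

Lemma exists_outer_arc m g : (c - d <= g)%N -> (0 < tops m (mu1 g))%N ->
  exists2 s, arc m s g & ~~ small B s.
Proof.
move=> gc /tops_gt0[a [b [ab /mu1_inj]]]; rewrite /top_col .
case: ifP => [sa Ea|/negbT sa <-]; last by exists a.
by have := outer_not_small gc; rewrite -Ea sa.
Qed.

Section Planar.
Context (m : mon) (gm : good_mon B m) (pm : planar m).

(** Tops in the last d columns are matched like closing parentheses, each with
    the nearest free bottom [s] on its left that is not small: a longer arc
    ending at [g] would pass over [s], which then lies under it or is the end
    of an arc that crosses it. *)
Lemma pick_outer_arc g s : (c - d <= g)%N -> (0 < tops m (mu1 g))%N ->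
    (forall g', (c - d <= g')%N -> (0 < tops m (mu1 g'))%N -> (g <= g')%N) ->
    (s < g)%N -> ~~ small B s -> (0 < bots m (mu2 s))%N ->
    (forall s', (s' < g)%N -> ~~ small B s' -> (0 < bots m (mu2 s'))%N ->
      (s' <= s)%N) ->
  arc m s g.
Proof.
move=> gc tg ming sg ns bs maxs; have [x xg nx] := exists_outer_arc gc tg.
have Ebot a b : ~~ small B a -> bot_col B a b = a.
  by rewrite /bot_col  => /negPf ->.
have xs : (x <= s)%N.
  apply: maxs => //; first exact: arc_lt xg.
  by have := arc_bots xg; rewrite Ebot.
have [H1 H2] := pm; move: xs; rewrite leq_eqVlt => /orP[/eqP/val_inj <- //|xs].
case: (bots_gt0 bs) => [hx|[a [b [ab]]]].
  by have := H2 _ _ _ xg hx; rewrite xs sg.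
rewrite /bot_col; case: ifP => [sa Eb|/negbT na Ea]; subst.
  have ax := small_lt sa nx.
  by have := H1 _ _ _ _ ab xg; rewrite ax xs sg.
have bc := arc_outer gm ab na; have gb : (g <= b)%N.
  apply: ming => //; have := arc_tops ab.
  by rewrite /top_col  (negPf na).
move: gb; rewrite leq_eqVlt => /orP[/eqP/val_inj -> //|gb].
by have := H1 _ _ _ _ xg ab; rewrite xs sg gb.
Qed.

Context (inner : forall g, (c - d <= g)%N -> tops m (mu1 g) = 0%N).

Lemma arc_small a b : arc m a b -> small B a.
Proof.
move=> ab; apply: contraT => na; have := arc_tops ab.
by rewrite /top_col  (negPf na) inner // (arc_outer gm ab na).
Qed.

Lemma exists_inner_arc s : (0 < tops m (mu1 s))%N -> exists t, arc m s t.
Proof.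
move=> /tops_gt0[a [b [ab /mu1_inj]]]; rewrite /top_col .
by rewrite (arc_small ab) => <-; exists b.
Qed.

(** Once no top is in the last d columns, the tops are matched like opening
    parentheses, each with the nearest free bottom on its right. *)
Lemma pick_inner_arc s t : (0 < tops m (mu1 s))%N ->
    (forall s', (0 < tops m (mu1 s'))%N -> (s' <= s)%N) ->
    (s < t)%N -> (0 < bots m (mu2 t))%N ->
    (forall t', (s < t')%N -> (0 < bots m (mu2 t'))%N -> (t <= t')%N) ->
  arc m s t.
Proof.
move=> ts maxs st bt mint; have [y sy] := exists_inner_arc ts.
have Ebot a b : arc m a b -> bot_col B a b = b.
  by move/arc_small; rewrite /bot_col  => ->.
have ty : (t <= y)%N.
  by apply: mint (arc_lt sy) _; have := arc_bots sy; rewrite Ebot.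
have [H1 H2] := pm; move: ty; rewrite leq_eqVlt => /orP[/eqP/val_inj -> //|ty].
case: (bots_gt0 bt) => [hx|[a [b [ab]]]].
  by have := H2 _ _ _ sy hx; rewrite st ty.
rewrite Ebot // => Eb; subst b; have as_ : (a <= s)%N.
  apply: maxs; have := arc_tops ab.
  by rewrite /top_col  (arc_small ab).
move: as_; rewrite leq_eqVlt => /orP[/eqP/val_inj <- //|as_].
by have := H1 _ _ _ _ ab sy; rewrite as_ st ty.
Qed.

End Planar.
End Recover.

Section Injectivity.
Context (d : nat) (n : 'I_d -> nat).
Context (n_gt0 : forall i : 'I_d, (1 <= n i)%N).
Context (n_mono : forall i j : 'I_d, (i <= j)%N -> (n i <= n j)%N).
Local Notation c := (ncols n).
Local Notation mon := 'X_{1..#|var n|}.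
Context (B : nat) (B_lt : (B < c)%N).
Implicit Types (s t g : 'I_c) (m : mon).

(** The arcs found by [pick_outer_arc] and [pick_inner_arc] depend on the tops
    and bottoms only. *)
Lemma common_arc m m' : good_mon B m -> good_mon B m' ->
    planar m -> planar m' -> tdeg m = tdeg m' -> (0 < tdeg m)%N ->
    lead_mon B m = lead_mon B m' ->
  exists s t, arc m s t /\ arc m' s t.
Proof.
move=> gm gm' pm pm' Et t0 El.
have [Etop Ebot] := lead_mon_split n_gt0 n_mono B_lt gm gm' Et El.
pose outer g := (c - d <= g)%N && (0 < tops B m (mu1 g))%N.
case: (pickP outer) => [g0 outer_g0|inner].
  case: (arg_minnP (fun g : 'I_c => g : nat) outer_g0) => g /andP[gc tg] ming.
  have [s0 s0g ns0] := exists_outer_arc gc tg.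
  pose under s := [&& s < g, ~~ small B s & 0 < bots B m (mu2 s)]%N.
  have under_s0 : under s0.
    rewrite /under (arc_lt s0g) ns0 /=.
    by have := arc_bots B s0g; rewrite /bot_col (negPf ns0).
  case: (arg_maxnP (fun s : 'I_c => s : nat) under_s0) => s /and3P[sg ns bs] maxs.
  exists s, g; split; apply: (pick_outer_arc n_gt0 n_mono B_lt _ _ gc) => //.
  - by move=> g' gc' tg'; apply: ming; rewrite /outer gc'.
  - by move=> s' *; apply: maxs; apply/and3P.
  - by rewrite -Etop.
  - by move=> g' gc' tg'; apply: ming; rewrite /outer gc' Etop.
  - by rewrite -Ebot.
  - by move=> s' ? ? bs'; apply: maxs; apply/and3P; rewrite Ebot.
have inner_m g : (c - d <= g)%N -> tops B m (mu1 g) = 0%N.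
  by move=> gc; have := inner g; rewrite /outer gc lt0n; case: eqP.
have inner_m' g : (c - d <= g)%N -> tops B m' (mu1 g) = 0%N.
  by rewrite -Etop; apply: inner_m.
pose is_top s := (0 < tops B m (mu1 s))%N.
have [s0 top_s0] : exists s, is_top s.
  move: t0; rewrite -(sum_tops B) lt0n sum_nat_eq0 negb_forall => /existsP[x].
  rewrite /= -lt0n => tx; have [a [b [_ Ex]]] := tops_gt0 tx.
  by exists (top_col B a b); rewrite /is_top Ex.
case: (arg_maxnP (fun s : 'I_c => s : nat) top_s0) => s tops_s maxs.
have [t0' st0] := exists_inner_arc n_gt0 n_mono B_lt gm inner_m tops_s.
pose after t := [&& s < t & 0 < bots B m (mu2 t)]%N.
have after_t0 : after t0'.
  rewrite /after (arc_lt st0) /=; have := arc_bots B st0.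
  by rewrite /bot_col (arc_small n_gt0 n_mono B_lt gm inner_m st0).
case: (arg_minnP (fun t : 'I_c => t : nat) after_t0) => t /andP[st bt] mint.
exists s, t; split.
  apply: (pick_inner_arc n_gt0 n_mono B_lt gm pm inner_m tops_s maxs st bt).
  by move=> t' st' bt'; apply: mint; rewrite /after st'.
apply: (pick_inner_arc n_gt0 n_mono B_lt gm' pm' inner_m') => //.
- by rewrite -Etop.
- by move=> s'; rewrite -Etop; apply: (maxs s').
- by rewrite -Ebot.
- by move=> t' st' bt'; apply: mint; rewrite /after st' Ebot.
Qed.

Lemma tdegD m m' : tdeg (m + m') = (tdeg m + tdeg m')%N.
Proof. by rewrite /tdeg -big_split; apply: eq_bigr => u _; rewrite mnmDE. Qed.

Lemma tdeg_tmon s t : (s < t)%N -> tdeg (tmon s t) = 1%N.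
Proof.
move=> st; rewrite /tdeg (tmonE st) (bigD1 (exist _ (s, t) st : tvar n)) //=.
rewrite mnm1E eqxx big1 // => u ne; rewrite mnm1E (inj_eq enum_rank_inj).
by apply/eqP; rewrite eqb0; apply: contra ne => /eqP[<-].
Qed.

Lemma lead_monD m m' : lead_mon B (m + m') = (lead_mon B m + lead_mon B m')%MM.
Proof.
rewrite /lead_mon -big_split /=; apply: eq_bigr => i _; apply/mnmP => j.
by rewrite mulmnE !mnmDE !mulmnE mulnDr.
Qed.

(** A common arc can be cancelled; without arcs the leading monomial is the
    monomial itself. *)
Lemma lead_mon_inj m m' : good_mon B m -> good_mon B m' ->
    planar m -> planar m' -> tdeg m = tdeg m' ->
  lead_mon B m = lead_mon B m' -> m = m'.
Proof.
have [k] := ubnP (tdeg m); elim: k m m' => // k IH m m'; rewrite ltnS => le_k.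
move=> gm gm' pm pm' Et El; case: (posnP (tdeg m)) => [t0|t_gt0].
  have [_ Ebot] := lead_mon_split n_gt0 n_mono B_lt gm gm' Et El.
  have T0 m1 u : tdeg m1 = 0%N -> m1 (enum_rank (inr u : var n)) = 0%N.
    by move/eqP; rewrite sum_nat_eq0 => /forallP/(_ u)/eqP.
  have Ebots m1 x : tdeg m1 = 0%N -> bots B m1 x = m1 (enum_rank (inl x : var n)).
    by move=> t1; rewrite /bots big1 ?addn0 // => u _; rewrite T0.
  apply/mnmP => i; rewrite -[i]enum_valK; case: (enum_val i) => [x|u].
    by rewrite -!Ebots -?Et.
  by rewrite !T0 -?Et.
have [s [t [st st']]] := common_arc gm gm' pm pm' Et t_gt0 El.
have lt := arc_lt st; have /andP[_ le] := st; have /andP[_ le'] := st'.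
rewrite -(submK le) -(submK le') in Et El *; congr (_ + _)%MM.
move: Et El; rewrite !tdegD !lead_monD => /addIn Et /addIm El.
apply: IH Et El.
- by move: le_k; rewrite -{1}(submK le) tdegD tdeg_tmon // addn1.
- exact: good_mon_le (lem_subr _ _) gm.
- exact: good_mon_le (lem_subr _ _) gm'.
- exact: planar_le (lem_subr _ _) pm.
- exact: planar_le (lem_subr _ _) pm'.
Qed.

End Injectivity.

(** * Standard monomials *)

Section Standard.
Context (K : fieldType) (d : nat) (n : 'I_d -> nat).
Context (n_gt0 : forall i : 'I_d, (1 <= n i)%N).
Context (n_mono : forall i j : 'I_d, (i <= j)%N -> (n i <= n j)%N).
Local Notation c := (ncols n).
Local Notation mon := 'X_{1..#|var n|}.
Implicit Types (a b g e s t : 'I_c) (x y : xvar n) (m : mon).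

Definition standard m : Prop :=
  forall (f : Sring K n) l, gen_lead f l -> ~~ (l <= m)%MM.

Lemma le_mnm1D N (i j : 'I_N) (m : 'X_{1..N}) : i != j ->
  (U_(i) <= m)%MM -> (U_(j) <= m)%MM -> (U_(i) + U_(j) <= m)%MM.
Proof.
move=> ij /mnm_lepP im /mnm_lepP jm; apply/mnm_lepP => k; rewrite mnmDE.
move: (im k) (jm k); rewrite !mnm1E; case: (eqVneq i k) => // <-.
by rewrite eq_sym (negPf ij) addn0.
Qed.

Lemma le_xt m x s t : has_x m x -> arc m s t -> (xmon x + tmon s t <= m)%MM.
Proof.
move=> hx /andP[st]; rewrite (tmonE st) => le; apply: le_mnm1D => //.
  by rewrite (inj_eq enum_rank_inj).
by rewrite lep1mP -lt0n.
Qed.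

Lemma le_tt m a b s t : arc m a b -> arc m s t -> (a != s) || (b != t) ->
  (tmon a b + tmon s t <= m)%MM.
Proof.
move=> /andP[ab]; rewrite (tmonE ab) => le /andP[st]; rewrite (tmonE st) => le' ne.
apply: le_mnm1D => //; rewrite (inj_eq enum_rank_inj).
by apply: contraTneq ne => -[-> ->]; rewrite !eqxx.
Qed.

Context (m : mon) (std_m : standard m).

Lemma standard_planar : planar m.
Proof.
split=> [a b g e ag be|a b g ag hx]; apply/negP.
  case/and3P=> ab bg ge.
  have abg : (a < b < g)%N by rewrite ab bg.
  case/negP: (std_m (LeadP K abg ge)).
  by apply: le_tt => //; rewrite (neq_lt ab).
by move=> abg; case/negP: (std_m (LeadM K abg)); apply: le_xt.
Qed.

(** Otherwise the monomial is divisible by the leading monomial of an L. *)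
Lemma standard_x x s t : has_x m x -> arc m s t ->
  (pos (mu1 s) <= pos x)%N || (pos (mu1 t) <= pos x)%N.
Proof.
move=> hx st; apply: contraT; rewrite negb_or -!ltnNge => /andP[xs xt].
have [f /std_m] := gen_lead_L K n_gt0 n_mono (arc_lt st) xs xt.
by rewrite le_xt.
Qed.

(** Otherwise s and t are barred columns, and the monomial is divisible by the
    leading monomial of a Q. *)
Lemma standard_arc a b s t : arc m a b -> arc m s t ->
  (pos (mu1 s) <= d + b)%N || (pos (mu1 t) <= d + b)%N.
Proof.
move=> ab st; apply: contraT; rewrite negb_or -!ltnNge => /andP[bs bt].
have db e : (d + b < pos (mu1 e))%N -> exists2 g : 'I_c, (b < g < c - d)%N & e = bar g.
  move=> lt; have lt_c : (pos (mu1 e) - d < c)%N by have := pos_mu1_lt n_gt0 e; lia.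
  have [|gc Ee] := @pos_mu1_bar _ _ n_gt0 e (Ordinal lt_c); first by rewrite /=; lia.
  by exists (Ordinal lt_c); rewrite // gc andbT /=; lia.
have [g /andP[bg gc] Es] := db _ bs; have [e /andP[be ec] Et] := db _ bt.
have lt := arc_lt ab.
have ne : (a != s) || (b != t).
  by apply/orP; left; rewrite neq_lt // Es; apply: ltn_trans (bar_gt n_gt0 gc); lia.
have := le_tt ab st ne; rewrite Es Et; case: (ltngtP g e) => [ge|eg|/val_inj E].
- by apply/contraLR => _; apply: std_m (LeadQ K _ ge ec); rewrite lt.
- rewrite [tmon (bar g) _]tmonC.
  by apply/contraLR => _; apply: std_m (LeadQ K _ eg gc); rewrite lt.
- by have := arc_lt st; rewrite Es Et E ltnn.
Qed.

(** The largest [B] below all positions of the x's and of the right ends of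
    the arcs; by the conditions above every arc then meets the columns whose
    first entry has position at most [B]. *)
Lemma standard_good (d_gt0 : (1 <= d)%N) : exists2 B, (B < c)%N & good_mon B m.
Proof.
have c_gt0 : (0 < c)%N by apply: leq_trans (d_le_c n_gt0).
pose ok B := [&& (B < c)%N, [forall x, has_x m x ==> (B <= pos x)%N]
  & [forall a, forall b, arc m a b ==> (B <= d + b)%N]].
have ok0 : exists B, ok B.
  exists 0%N; apply/and3P; split=> //; first by apply/forallP => x; rewrite implybT.
  by apply/forallP => a; apply/forallP => b; rewrite implybT.
have ok_le B : ok B -> (B <= c)%N by case/and3P => /ltnW.
case: (ex_maxnP ok0 ok_le) => B /and3P[Bc /forallP xB /forallP arcB] maxB.
have {}arcB a b : arc m a b -> (B <= d + b)%N.
  by have /forallP/(_ b)/implyP := arcB a.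
exists B => //; apply/forallP => i; rewrite -[i]enum_valK enum_rankK.
apply/implyP; case: (enum_val i) => [x|[[s t] /= st]]; first exact: (implyP (xB x)).
rewrite -arcE => arc_st; rewrite (arcB _ _ arc_st) /=.
case: (boolP (ok B.+1)) => [/maxB|]; first by rewrite ltnn.
rewrite !negb_and => /or3P[].
- by have := pos_mu1_lt n_gt0 s; lia.
- rewrite negb_forall => /existsP[x]; rewrite negb_imply => /andP[hx].
  by have := standard_x hx arc_st; lia.
- rewrite negb_forall => /existsP[a]; rewrite negb_forall => /existsP[b].
  rewrite negb_imply => /andP[ab]; have := standard_arc ab arc_st; lia.
Qed.

End Standard.

(** * Linear independence of the standard monomials *)

Section Independence.
Context (K : fieldType) (d : nat) (n : 'I_d -> nat).
Context (n_gt0 : forall i : 'I_d, (1 <= n i)%N).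
Context (n_mono : forall i j : 'I_d, (i <= j)%N -> (n i <= n j)%N).
Local Notation c := (ncols n).
Local Notation mon := 'X_{1..#|var n|}.
Implicit Types (m : mon).

Lemma seq_argmax (T : eqType) (f : T -> nat) (s : seq T) x : x \in s ->
  exists2 y, y \in s & forall z, z \in s -> (f z <= f y)%N.
Proof.
elim: s x => // x s IH _ _; case: s IH => [_|z s IH].
  by exists x => [|y]; rewrite inE // => /eqP ->.
have [y ys maxy] := IH z (mem_head _ _); case: (leqP (f y) (f x)) => xy.
  exists x => [|w]; rewrite inE ?eqxx // => /orP[/eqP -> //|/maxy le].
  exact: leq_trans xy.
exists y => [|w]; first by rewrite inE ys orbT.
by rewrite inE => /orP[/eqP ->|/maxy //]; apply: ltnW.
Qed.

(** The part of [mon_lam] that does not depend on [B]. *)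
Definition base_lam m : nat :=
  (\sum_x m (enum_rank (inl x : var n)) * lam x +
   \sum_u m (enum_rank (inr u : var n)) *
     (lam (mu2 (val u).1) + lam (mu2 (val u).2)))%N.

Lemma mon_lamE B m : mon_lam B m = (base_lam m + tdeg m * (c - B))%N.
Proof.
rewrite /mon_lam big_var /= /base_lam /tdeg big_distrl -addnA -big_split /=.
congr (_ + _)%N; apply: eq_bigr => i _; rewrite enum_rankK //=.
by rewrite mulnDr.
Qed.

(** In a relation choose a monomial m0 of maximal [base_lam] and the [B] that
    [standard_good] gives for it. The images of the monomials that are not
    good for this [B], or of smaller [base_lam], have weight [nu] less than
    that of m0. The others have distinct leading monomials, so the largest one
    for [rho] does not cancel. *)
Lemma standard_indep (d_gt0 : (1 <= d)%N) (r : Sring K n) : Pi r = 0 ->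
  (forall m, m \in msupp r -> standard K m) -> r = 0.
Proof.
move=> Pi0 std_r; apply/eqP; apply: contraT => r0.
have [m mr] : exists m, m \in msupp r.
  by exists (mlead r); apply: mlead_supp.
pose k := tdeg m; pose S := [seq m <- msupp r | tdeg m == k].
have [m0] : exists2 m0, m0 \in S &
    forall m', m' \in S -> (base_lam m' <= base_lam m0)%N.
  by apply: (@seq_argmax _ _ _ m); rewrite mem_filter eqxx.
rewrite mem_filter => /andP[/eqP t0 m0r] max0.
have [B Bc good0] := standard_good n_gt0 n_mono (std_r _ m0r) d_gt0.
pose X := [seq m <- S | (base_lam m == base_lam m0) && good_mon B m].
have [m1] : exists2 m1, m1 \in X &
    forall m', m' \in X ->
      (weight (rho B) (lead_mon B m') <= weight (rho B) (lead_mon B m1))%N.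
  apply: (@seq_argmax _ (fun m => weight (rho B) (lead_mon B m)) _ m0).
  by rewrite !mem_filter eqxx good0 t0 eqxx.
rewrite !mem_filter => /andP[/andP[/eqP b1 good1] /andP[/eqP t1 m1r]] max1.
have lamS m' : m' \in S -> mon_lam B m' = (base_lam m' + k * (c - B))%N.
  by rewrite mem_filter mon_lamE => /andP[/eqP ->].
have m1S : m1 \in S by rewrite mem_filter t1 eqxx.
have [lead1 w1] := Pi_mon_lead K n_gt0 n_mono Bc good1.
have := congr1 (fun p : {poly Rring K n} => (p`_k)@_(lead_mon B m1)) Pi0.
rewrite /= PiE coef0 mcoeff0 linear_sum /= -big_filter -/S.
rewrite (bigD1_seq m1) ?filter_uniq ?msupp_uniq //=.
rewrite big1_seq ?addr0 => [|m' /andP[ne m'S]]; last first.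
  have [t' m'r] : tdeg m' = k /\ m' \in msupp r.
    by move: m'S; rewrite mem_filter => /andP[/eqP ->].
  rewrite mcoeffZ [(Pi_mon K m')@_ _]memN_msupp_eq0 ?mulr0 //; apply/negP => lead1_m'.
  have w1' := w1; rewrite lamS // b1 in w1'.
  have le_b := max0 _ m'S.
  case: (boolP (good_mon B m')) => [good'|bad]; last first.
    have := Pi_mon_lt n_gt0 Bc bad lead1_m'.
    by rewrite lamS // w1' ltn_add2r ltnNge le_b.
  have := Pi_mon_le n_gt0 Bc lead1_m'; rewrite lamS // w1' leq_add2r => ge_b.
  have Eb : base_lam m' = base_lam m0 by apply/eqP; rewrite eqn_leq le_b ge_b.
  have [[a [p [a0 Ep Hp]]] w'] := Pi_mon_lead K n_gt0 n_mono Bc good'.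
  have neq_lead : lead_mon B m' != lead_mon B m1.
    apply: contra ne => /eqP El; apply/eqP.
    apply: (lead_mon_inj n_gt0 n_mono Bc good' good1) El.
    - by apply: standard_planar (std_r _ m'r).
    - by apply: standard_planar (std_r _ m1r).
    - by rewrite t' t1.
  move: lead1_m'; rewrite Ep => /msuppD_le; rewrite mem_cat => /orP[/msuppZ_le|/Hp].
    by rewrite msuppX inE eq_sym (negPf neq_lead).
  have /max1 : m' \in X by rewrite mem_filter m'S good' Eb eqxx.
  by rewrite /ltw w' lamS // Eb w1' ltnn eqxx /= leqNgt => /negP.
move/eqP; rewrite mcoeffZ mulf_eq0 mcoeff_eq0 m1r /=.
case: lead1 => a [p [a0 -> Hp]]; rewrite mcoeffD mcoeffZ mcoeffX eqxx mulr1.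
rewrite memN_msupp_eq0 ?addr0 ?(negPf a0) //.
by apply: contraFN (ltw_irr B (lead_mon B m1)) => /Hp.
Qed.

(** * The defining ideal of the Rees ring *)

Lemma rees_ideal0 : rees_ideal (0 : Sring K n).
Proof. by rewrite /rees_ideal /Pi mmap0. Qed.

Lemma PiB (f g : Sring K n) : Pi (f - g) = Pi f - Pi g.
Proof. exact: mmapB. Qed.

Lemma PiD (f g : Sring K n) : Pi (f + g) = Pi f + Pi g.
Proof. exact: mmapD. Qed.

Lemma PiM (f g : Sring K n) : Pi (f * g) = Pi f * Pi g.
Proof. by rewrite [LHS]rmorphM. Qed.

Lemma rees_idealD (f g : Sring K n) :
  rees_ideal f -> rees_ideal g -> rees_ideal (f + g).
Proof. by rewrite /rees_ideal PiD => -> ->; rewrite addr0. Qed.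

Lemma rees_idealM (f g : Sring K n) : rees_ideal g -> rees_ideal (f * g).
Proof. by rewrite /rees_ideal PiM => ->; rewrite mulr0. Qed.

Lemma Pi_XS x : Pi (XS K (n := n) x) = (XR K x)%:P.
Proof. exact: PiX. Qed.

Lemma Pi_T (a b : 'I_c) : Pi (T K a b) = (minor K a b)%:P * 'X.
Proof.
have lt (e g : 'I_c) : (e < g)%N -> Pi (T K e g) = (minor K e g)%:P * 'X.
  move=> eg; rewrite mul_polyC T_lt // (tmonE eg); exact: PiX.
case: (ltngtP a b) => [/lt //|ba|/val_inj ->].
  rewrite T_anti [LHS]mmapN [mmap _ _ _](lt _ _ ba) -mulNr -polyCN.
  by congr (_%:P * _); rewrite /minor; ring.
rewrite /T !insubF /= ?ltnn // [LHS]mmap0 /minor subrr polyC0 mul0r //.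
Qed.

Lemma gens_rees_ideal (f : Sring K n) : rees_gens f -> rees_ideal f.
Proof.
have PiE' := (PiB, PiD, PiM, Pi_XS, Pi_T).
case=> [a b g e _ _|a b g e abg ge ec|a b g _|a b g _].
- by rewrite /rees_ideal /P !PiE' /minor !rmorphB !rmorphM /=; ring.
- have [ac bc gc] : [/\ (a < c - d)%N, (b < c - d)%N & (g < c - d)%N] by split; lia.
  rewrite /rees_ideal /Q !PiE' /minor !bar_spec // !rmorphB !rmorphM /=; ring.
- by rewrite /rees_ideal /L !PiE' /minor !rmorphB !rmorphM /=; ring.
- by rewrite /rees_ideal /M !PiE' /minor !rmorphB !rmorphM /=; ring.
Qed.

Lemma standard_or_div m : standard K m \/
  exists (f : Sring K n) l, [/\ rees_gens f, is_lead (@mon_lt d n) f l & (l <= m)%MM].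
Proof.
case: (classic (exists (f : Sring K n) l, gen_lead f l /\ (l <= m)%MM)).
  move=> [f [l [fl lm]]]; right; exists f, l; split=> //.
    exact: gen_lead_gens fl.
  exact/leads_is_lead/gen_lead_leads.
by move=> no; left => f l fl; apply/negP => lm; case: no; exists f, l.
Qed.

End Independence.

Theorem theorem4p10 (K : fieldType) (d : nat) (n : 'I_d -> nat)
    (d_gt0 : (1 <= d)%N)
    (n_gt0 : forall i : 'I_d, (1 <= n i)%N)
    (n_mono : forall i j : 'I_d, (i <= j)%N -> (n i <= n j)%N) :
  [/\ minimal_generators (@rees_gens K d n) (@rees_ideal K d n),
      groebner_basis (@mon_lt d n) (@rees_gens K d n) (@rees_ideal K d n),
      forall g : Sring K n, rees_gens g -> g \is 2.-homog
    & forall g : Sring K n, rees_gens g ->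
        exists2 m, is_lead (@mon_lt d n) g m & squarefree m].
Proof.
have lt_irr := @mon_lt_irr d n; have lt_trans := mon_lt_trans n_gt0.
have lt_add := @mon_lt_add d n.
have indep r := @standard_indep K d n n_gt0 n_mono d_gt0 r.
have lead_inj (g h : Sring K n) m : rees_gens g -> rees_gens h ->
    is_lead (@mon_lt d n) g m -> is_lead (@mon_lt d n) h m -> g = h.
  move=> Gg Gh /(gens_lead_gen_lead n_gt0 n_mono Gg) lg.
  by move=> /(gens_lead_gen_lead n_gt0 n_mono Gh); apply: gen_lead_inj lg.
have lead := @gens_lead K d n n_gt0 n_mono.
have gens_deg := @gens_homog K d n n_gt0 n_mono.
have std := @standard_or_div K d n n_gt0 n_mono.
have [J0 [JD JM]] := (@rees_ideal0 K d n, (@rees_idealD K d n, @rees_idealM K d n)).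
have GJ := @gens_rees_ideal K d n n_gt0.
split.
- exact: (criterion_minimal lt_irr lt_trans lt_add lead gens_deg std J0 JD JM GJ
    indep lead_inj).
- exact: (criterion_groebner lt_irr lt_trans lt_add gens_deg std J0 JD JM GJ indep).
- by move=> g Gg; apply/dhomogP => m; apply: gens_deg.
- move=> g /gens_gen_lead[] // m lead_m; exists m.
    exact/leads_is_lead/gen_lead_leads.
  exact: gen_lead_squarefree lead_m.
Qed.
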